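(* Let $\Omega\subset\mathbb{R}^d$ be closed and convex with $0\in\Omega$. If $(u,v)$ is a self-similar solution of the system $$\begin{cases}H(t)\nabla u^2+K(t)\nabla\cdot(u\,v\otimes v)+\frac{d}{dt}(K(t)u\,v)=0&\text{in }\Omega,\\ \frac{d}{dt}u+\nabla\cdot(vu)=0&\text{in }\Omega,\\ u\,v\cdot n=0&\text{on }\partial\Omega,\\ \lim_{t\downarrow0}u(t,\cdot)\mathcal{L}^d=\mu_0,\qquad\lim_{t\uparrow1}u(t,\cdot)\mathcal{L}^d=\mu_1,\end{cases}$$ with $H(t)=-V(t)^{1/2}$ and $K(t)=F(t)V(t)^{-1/2}$, and with $u$ Lipschitz continuous, then necessarily $u$ is of the form $$u(t,x)=(A_t-B_t|x|^2)\vee0$$ for suitable coefficients $A_t,B_t>0$.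
   Context: $\mathcal{L}^d$ is Lebesgue measure, $n$ is the outer normal to $\partial\Omega$, $a\vee b=\max\{a,b\}$. $W_2(\Omega)$ is the set of Borel probability measures on $\Omega$ with finite second moment, with the quadratic Wasserstein distance. Self-similar: $\mu_t:=u(t,\cdot)\mathcal{L}^d$, $t\in[0,1]$, is a curve of probability measures in $W_2(\Omega)$ of the form $\mu_t=(T_{R(t)})_\sharp\bar\mu$ for a fixed measure $\bar\mu$ and a regular function $R:[0,1]\to(0,1]$, where $T_R(x)=Rx$ (homothety centered at the origin), and $v$ is the tangent field of the curve, $v_t(x)=xR'(t)/R(t)$ (the tangent field is the velocity field, i.e. solution of the continuity equation, of minimal $L^2(\mu_t)$ norm for a.e. $t$). Here $$F(t)=\int_\Omega u(t,x)^2\,dx,\qquad V(t)=\int_\Omega|v_t|^2u(t,x)\,dx,$$ and $V(t)>0$ for a.e. $t$, so that $K$ is defined. The system is understood in the weak sense: for every $\xi\in C^\infty_c((0,1)\times\mathrm{int}\,\Omega;\mathbb{R}^d)$, $\int_0^1H\int_\Omega(\nabla\cdot\xi)u^2\,dx\,dt+\int_0^1K\int_\Omega u\,(\nabla\xi\cdot v+\partial_t\xi)\cdot v\,dx\,dt=0$ (with $\nabla\xi\cdot v$ the spatial Jacobian of $\xi$ applied to $v$); the continuity equation with the boundary condition means $\frac{d}{dt}\int\phi\,u\,dx=\int\nabla\phi\cdot v\,u\,dx$ for a.e. $t$ and all $\phi\in C^1_c(\Omega)$, not required to vanish on $\partial\Omega$; the limits are weak limits of measures. *)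

(* Defs.v *)
From HB Require Import structures.
From mathcomp Require Import all_boot all_order all_algebra.
From mathcomp Require Import all_classical all_reals all_analysis.
From mathcomp Require Import measurable_realfun.

Set Implicit Arguments.
Unset Strict Implicit.
Unset Printing Implicit Defensive.
Import Order.TTheory GRing.Theory Num.Theory.
Import numFieldNormedType.Exports.
Local Open Scope classical_set_scope.
Local Open Scope ring_scope.

(* Borel sigma-algebra of R^d, for the library's topology on matrices. *)
HB.instance Definition _ (R : realType) (m n : nat) :=
  @isMeasurable.Build default_measure_display 'M[R]_(m, n)
    <<s (@open 'M[R]_(m, n)) >> (@sigma_algebra0 _ setT _)
    (@sigma_algebraC 'M[R]_(m, n) _) (@sigma_algebra_bigcup _ setT _).

Lemma measurable_coord (R : realType) n (i : 'I_n) :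
  measurable_fun setT (fun x : 'rV[R]_n => x 0 i).
Proof.
apply: (measurability _ (RGenOpens.measurableE R)) => _ [_ [a [b ->]] <-].
rewrite setTI; apply: sub_sigma_algebra.
apply: open_comp; first by move=> x _; exact: coord_continuous.
exact: interval_open.
Qed.

Lemma measurable_rV_valued (R : realType) d (T : measurableType d) n
    (f : T -> 'rV[R]_n) :
  (forall i, measurable_fun setT (fun x => f x 0 i)) -> measurable_fun setT f.
Proof.
move=> mf.
pose B (p : 'rV[rat]_n * nat) : set 'rV[R]_n :=
  [set x | forall i, ball (ratr (p.1 0 i) : R) (p.2.+1%:R^-1) (x 0 i)].
have mB p : measurable (f @^-1` B p).
  rewrite [X in measurable X](_ : _ =
    \big[setI/setT]_(i < n)
      ((fun x => f x 0 i) @^-1` ball (ratr (p.1 0 i) : R) (p.2.+1%:R^-1))).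
    apply: bigsetI_measurable => i _; rewrite -[X in measurable X]setTI.
    by apply: mf => //; exact: measurable_ball.
  rewrite -bigcap_seq; apply/seteqP; split=> x /=.
    by move=> h i _; exact: h.
  by move=> h i; apply: h => /=; rewrite mem_index_enum.
apply: (measurability (@open 'rV[R]_n) erefl) => _ [U oU <-]; rewrite setTI.
rewrite [X in measurable X](_ : _ =
    \bigcup_(p in [set p | B p `<=` U]) f @^-1` B p); last first.
  apply/seteqP; split=> [x /= Ufx|x [p pU]]; last exact: pU.
  have /nbhs_ballP[e /= e0 eU] : nbhs (f x) U by exact: open_nbhs_nbhs.
  have [k ke] : exists k : nat, k.+1%:R^-1 < e / 2.
    have e2 : 0 < e / 2 by rewrite divr_gt0.
    near \oo => k; exists k; near: k.
    exact: (near_infty_natSinv_lt (PosNum e2)).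
  have q_ (i : 'I_n) : {q : rat | `|ratr q - f x 0 i| < k.+1%:R^-1}.
    apply: cid.
    have /rat_in_itvoo[q] : f x 0 i - k.+1%:R^-1 < f x 0 i + k.+1%:R^-1.
      by rewrite ltrD2l gtrN.
    by rewrite in_itv/= => hq; exists q; rewrite ltr_distl.
  exists (\row_i sval (q_ i), k) => /=; last first.
    by move=> i /=; rewrite mxE; exact: (svalP (q_ i)).
  move=> y By; apply: eU; split => // i j; rewrite (ord1 i).
  have := By j; rewrite /= mxE => By'.
  rewrite /ball /= (splitr e) (le_lt_trans (ler_distD (ratr (sval (q_ j))) _ _))//.
  rewrite ltrD// (lt_trans _ ke)//.
  by rewrite distrC; exact: (svalP (q_ j)).
rewrite bigcup_mkcond.
by apply: countable_bigcupT_measurable => // p; case: ifPn.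
Unshelve. all: by end_near. Qed.

Definition rV_cons (R : realType) n (p : measurableTypeR R * 'rV[R]_n) :
    'rV[R]_n.+1 :=
  row_mx (p.1 : R)%:M p.2 : 'rV[R]_(1 + n).

Definition rV_uncons (R : realType) n (x : 'rV[R]_n.+1) :
    measurableTypeR R * 'rV[R]_n :=
  (x 0 0, rsubmx (x : 'rV[R]_(1 + n))).

Lemma rV_cons0 (R : realType) n (p : measurableTypeR R * 'rV[R]_n) :
  rV_cons p 0 0 = p.1.
Proof.
transitivity (row_mx (p.1 : R)%:M p.2 0 (lshift n 0)).
  by congr (_ _ _); exact: val_inj.
by rewrite row_mxEl mxE eqxx.
Qed.

Lemma rV_consS (R : realType) n (p : measurableTypeR R * 'rV[R]_n) (i : 'I_n) :
  rV_cons p 0 (lift ord0 i) = p.2 0 i.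
Proof.
transitivity (row_mx (p.1 : R)%:M p.2 0 (rshift 1 i)).
  by congr (_ _ _); exact: val_inj.
by rewrite row_mxEr.
Qed.

Lemma rV_uncons2E (R : realType) n (x : 'rV[R]_n.+1) i :
  (rV_uncons x).2 0 i = x 0 (lift ord0 i).
Proof. by rewrite mxE; congr (x _ _); exact: val_inj. Qed.

Lemma rV_consK (R : realType) n : cancel (@rV_cons R n) (@rV_uncons R n).
Proof.
move=> [a x]; congr pair; first exact: rV_cons0.
by apply/rowP => i; rewrite rV_uncons2E rV_consS.
Qed.

Lemma measurable_rV_cons (R : realType) n :
  measurable_fun setT (@rV_cons R n).
Proof.
apply: measurable_rV_valued => i; have [j ->|->] := unliftP ord0 i.
  under eq_fun do rewrite rV_consS.
  by apply: (measurableT_comp (measurable_coord j)); exact: measurable_snd.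
by under eq_fun do rewrite rV_cons0; exact: measurable_fst.
Qed.

Lemma measurable_rV_uncons (R : realType) n :
  measurable_fun setT (@rV_uncons R n).
Proof.
apply/measurable_fun_pairP; split; first exact: measurable_coord.
apply: measurable_rV_valued => i; under eq_fun do rewrite /= rV_uncons2E.
exact: measurable_coord.
Qed.

(* The image of the product of Lebesgue measure on R and of m on R^n under
   R * R^n ~ R^(n+1). *)
Definition cons_measure (R : realType) n
    (m : {sigma_finite_measure set 'rV[R]_n -> \bar R}) :=
  pushforward (@lebesgue_measure R \x m)%E (@rV_cons R n).

Section cons_measure_instances.
Context (R : realType) (n : nat)
  (m : {sigma_finite_measure set 'rV[R]_n -> \bar R}).

Let cons_measure0 : cons_measure m set0 = 0%E.
Proof. by rewrite /cons_measure /pushforward preimage_set0 measure0. Qed.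

Let cons_measure_ge0 A : (0 <= cons_measure m A)%E.
Proof. by rewrite /cons_measure /pushforward; apply: measure_ge0. Qed.

Let cons_measure_semi_sigma_additive : semi_sigma_additive (cons_measure m).
Proof.
have mC A : measurable A -> measurable (@rV_cons R n @^-1` A).
  by move=> mA; rewrite -[X in measurable X]setTI; exact: measurable_rV_cons.
move=> F mF tF mUF; rewrite /cons_measure /pushforward preimage_bigcup.
apply: measure_semi_sigma_additive => [i||].
- by apply: mC; exact: mF.
- apply/trivIsetP => /= i j _ _ ij; rewrite -preimage_setI.
  by move/trivIsetP : tF => /(_ _ _ _ _ ij) ->//; rewrite preimage_set0.
- by rewrite -preimage_bigcup; exact: mC.
Qed.

HB.instance Definition _ := isMeasure.Build _ _ _ (cons_measure m)
  cons_measure0 cons_measure_ge0 cons_measure_semi_sigma_additive.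

Let cons_measure_sigma_finite : sigma_finite setT (cons_measure m).
Proof.
have /sigma_finiteP[F [FT ndF Foo]] := sigma_finiteT (@lebesgue_measure R).
have /sigma_finiteP[G [GT ndG Goo]] := sigma_finiteT m.
exists (fun k => @rV_uncons R n @^-1` (F k `*` G k)).
  apply/esym; rewrite -subTset => x _.
  have [i _ Fi] : (\bigcup_i F i) (rV_uncons x).1 by rewrite -FT.
  have [j _ Gj] : (\bigcup_i G i) (rV_uncons x).2 by rewrite -GT.
  exists (maxn i j) => //; split.
    by move: Fi; exact/subsetPset/ndF/leq_maxl.
  by move: Gj; exact/subsetPset/ndG/leq_maxr.
move=> k; have [mF Fkoo] := Foo k; have [mG Gkoo] := Goo k; split.
  rewrite -[X in measurable X]setTI; apply: measurable_rV_uncons => //.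
  exact: measurableX.
rewrite /cons_measure /pushforward -comp_preimage.
rewrite (_ : @rV_uncons R n \o @rV_cons R n = id); last first.
  by apply/funext => p; exact: rV_consK.
by rewrite preimage_id product_measure1E// lte_mul_pinfty// ge0_fin_numE.
Qed.

HB.instance Definition _ := Measure_isSigmaFinite.Build _ _ _ (cons_measure m)
  cons_measure_sigma_finite.

End cons_measure_instances.

Fixpoint lebesgue_rV_rec (R : realType) (n : nat) :
    {sigma_finite_measure set 'rV[R]_n -> \bar R} :=
  if n is n'.+1 then cons_measure (lebesgue_rV_rec R n')
  else dirac (0 : 'rV[R]_0).

Definition lebesgue_rV (R : realType) (d : nat) : set 'rV[R]_d -> \bar R :=
  lebesgue_rV_rec R d.

HB.instance Definition _ (R : realType) d :=
  SigmaFiniteMeasure.on (@lebesgue_rV R d).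

Lemma lebesgue_rV_box (R : realType) d (A : 'I_d -> set (measurableTypeR R)) :
  (forall i, measurable (A i)) ->
  lebesgue_rV [set x : 'rV[R]_d | forall i, A i (x 0 i)] =
  (\prod_(i < d) @lebesgue_measure R (A i))%E.
Proof.
rewrite /lebesgue_rV; elim: d A => [|d IH] A mA /=.
  by rewrite big_ord0 diracE mem_set// => -[].
rewrite big_ord_recl -(IH (fun i => A (lift ord0 i)))//.
have mB : measurable
    [set x : 'rV[R]_d | forall i, A (lift ord0 i) (x 0 i)].
  rewrite [X in measurable X](_ : _ =
    \big[setI/setT]_(i < d) ((fun x : 'rV[R]_d => x 0 i) @^-1` A (lift ord0 i))).
    apply: bigsetI_measurable => i _; rewrite -[X in measurable X]setTI.
    by apply: measurable_coord => //; exact: mA.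
  rewrite -bigcap_seq; apply/seteqP; split=> x /=.
    by move=> h i _; exact: h.
  by move=> h i; apply: h => /=; rewrite mem_index_enum.
rewrite -product_measure1E// /cons_measure /pushforward; congr product_measure1.
apply/seteqP; split=> [[a x] /= h|[a x] /= [Aa Ax] i].
  split; first by have := h ord0; rewrite rV_cons0.
  by move=> i; have := h (lift ord0 i); rewrite rV_consS.
by have [j ->|->] := unliftP ord0 i; rewrite ?rV_cons0 ?rV_consS.
Qed.

Definition dotr (R : realType) d (x y : 'rV[R]_d) : R :=
  \sum_(i < d) x 0 i * y 0 i.

(* Euclidean; the library's norm on 'rV[R]_d is the sup norm. *)
Definition sqnorm (R : realType) d (x : 'rV[R]_d) : R := dotr x x.

Definition divergence (R : realType) d (f : 'rV[R]_d -> 'rV[R]_d)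
    (x : 'rV[R]_d) : R :=
  \tr ('J f x).

Definition iter_derive (R : realType) (V W : normedModType R) (vs : seq V)
    (f : V -> W) : V -> W :=
  foldr (fun v g => 'D_v g) f vs.

(* C^infty: total differentiability of every iterated directional derivative
   also makes all of them continuous. *)
Definition smooth (R : realType) (V W : normedModType R) (f : V -> W) :=
  forall (vs : seq V) (x : V), differentiable (iter_derive vs f) x.

(* Test functions phi in C^1_c(Omega), Omega closed: restrictions to Omega of
   such phi, so phi need not vanish on the boundary. *)
Definition C1c (R : realType) d (phi : 'rV[R]_d -> R) :=
  [/\ forall x, differentiable phi x,
      forall v, continuous ('D_v phi) &
      exists2 C, compact C & forall x, ~ C x -> phi x = 0].

Definition C1_on_01 (R : realType) (r : R -> R) :=
  {within `[0, 1], continuous r} /\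
  exists2 r' : R -> R, {within `[0, 1], continuous r'} &
    forall t : R, 0 < t < 1 -> is_derive t 1 r (r' t).

Section system.
Context (R : realType) (d : nat).
Implicit Types (Omega : set 'rV[R]_d) (u : R -> 'rV[R]_d -> R)
  (v w : R -> 'rV[R]_d -> 'rV[R]_d) (xi : R * 'rV[R]_d -> 'rV[R]_d).

Local Notation leb := (@lebesgue_measure R).
Local Notation Leb := (@lebesgue_rV R d).

(* Measures on Omega are represented by measures on R^d concentrated on it. *)
Definition wasserstein2 Omega (mu : probability 'rV[R]_d R) :=
  mu (~` Omega) = 0%E /\ (\int[mu]_x (sqnorm x)%:E < +oo)%E.

Definition Ffun Omega u (t : R) : R :=
  \int[Leb]_(x in Omega) (u t x ^+ 2).

Definition Vfun Omega u v (t : R) : R :=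
  \int[Leb]_(x in Omega) (sqnorm (v t x) * u t x).

Definition Hfun Omega u v (t : R) : R := - Num.sqrt (Vfun Omega u v t).

Definition Kfun Omega u v (t : R) : R :=
  Ffun Omega u t / Num.sqrt (Vfun Omega u v t).

Definition momentum_test Omega xi :=
  smooth xi /\
  exists2 C : set (R * 'rV[R]_d), compact C &
    C `<=` `]0, 1[%classic `*` Omega° /\ forall p, ~ C p -> xi p = 0.

(* Weak form of H grad(u^2) + K div(u v (x) v) + d/dt (K u v) = 0; the term
   ['d (fun y => xi (t, y)) x (v t x)] is the spatial Jacobian of xi applied to
   v. *)
Definition momentum_equation Omega u v :=
  forall xi, momentum_test Omega xi ->
    \int[leb]_(t in `]0, 1[) (Hfun Omega u v t *
      \int[Leb]_(x in Omega)
        (divergence (fun y => xi (t, y)) x * u t x ^+ 2)) +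
    \int[leb]_(t in `]0, 1[) (Kfun Omega u v t *
      \int[Leb]_(x in Omega)
        (u t x * dotr ('d (fun y => xi (t, y)) x (v t x) +
                       derive1 (fun s => xi (s, x)) t) (v t x))) = 0.

(* Since phi need not vanish on the boundary of Omega, this includes the no-flux
   condition u v . n = 0. *)
Definition continuity_equation Omega u v :=
  {ae leb, forall t : R, 0 < t < 1 -> forall phi, C1c phi ->
    is_derive t 1 (fun s : R => \int[Leb]_(x in Omega) (phi x * u s x))
      (\int[Leb]_(x in Omega) ('d phi x (v t x) * u t x))}.

Definition weak_cvg Omega u (F : set_system R) (nu : probability 'rV[R]_d R) :=
  forall phi : 'rV[R]_d -> R, continuous phi ->
    (exists M, forall x, `|phi x| <= M) ->
    \int[Leb]_(x in Omega) (phi x * u t x) @[t --> F] --> \int[nu]_x phi x.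

Definition solution Omega u v (mu0 mu1 : probability 'rV[R]_d R) :=
  [/\ momentum_equation Omega u v,
      continuity_equation Omega u v,
      weak_cvg Omega u 0^'+ mu0 &
      weak_cvg Omega u 1^'- mu1].

(* The solution of the continuity equation of minimal L^2(mu_t) norm for a.e. t,
   where mu_t has density u t on Omega. *)
Definition tangent_field Omega u v :=
  continuity_equation Omega u v /\
  forall w, (forall t, measurable_fun Omega (w t)) ->
    continuity_equation Omega u w ->
    {ae leb, forall t : R, 0 < t < 1 ->
      (\int[Leb]_(x in Omega) (sqnorm (v t x) * u t x)%:E <=
       \int[Leb]_(x in Omega) (sqnorm (w t x) * u t x)%:E)%E}.

Definition self_similar Omega u v :=
  exists (mubar : {measure set 'rV[R]_d -> \bar R}) (r : R -> R)
         (mu : R -> probability 'rV[R]_d R),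
  [/\ C1_on_01 r /\ (forall t, 0 <= t <= 1 -> 0 < r t <= 1),
      forall t, 0 <= t <= 1 -> wasserstein2 Omega (mu t) /\
        forall A, measurable A ->
          mu t A = (\int[Leb]_(x in A `&` Omega) (u t x)%:E)%E /\
          mu t A = pushforward mubar (fun x => r t *: x) A,
      tangent_field Omega u v &
      forall t x, 0 < t < 1 -> Omega x -> v t x = (derive1 r t / r t) *: x].

End system.

(* Main.v *)
Require Import Defs.
From HB Require Import structures.
From mathcomp Require Import all_boot all_order all_algebra.
From mathcomp Require Import all_classical all_reals all_analysis.
From mathcomp Require Import measurable_realfun.
From mathcomp Require Import ring lra.

(** Along a self-similar curve the velocity is [(r' / r) x], and all densities
are dilations of one of them. Formally, the momentum equation then reduces at
each time to [- 2 H u grad u = c u x] with a scalar [c]; hence [grad u] is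
parallel to [x] with a constant factor where [u] is positive, and [u] is there
[A - B |x|^2].

The time dependence is eliminated at a single time [t0] with [V t0 > 0]. Write
[U] for the density at [t0] extended by [0], and [rho = r / r t0]. Scaling
gives [V = (r' / r t0)^2 M] and [F = rho^(- d) F0], where [M] is the second
moment of [U] and [F0] the integral of [U^2]. Near [t0] the derivative [r']
keeps its sign, so that [K r' / r] is a constant times [rho^(- d - 1)].
Testing with fields [theta t phi x x] and integrating by parts in time leaves
the radial weak equation ([momentum_identity])
  [int (d phi + x . grad phi) U^2 = kappa int phi |x|^2 U],
  [kappa = d F0 / M].

No scaling of time is left, but the test functions may still be dilated: if
[phi] is a bump near [w], then [phi (x / l)] is a bump near [l w], supported
in [Omega] by convexity when [l <= 1]. Differentiating in [l] and letting the
bump concentrate shows that [q l = U (l w)] satisfies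
[(q^2)' = - kappa |w|^2 l q] ([is_derive_ray]). The truncated parabola
satisfies the same equation with the same value at [0], and the equation has
only one nonnegative solution because its right-hand side decreases with [q]
([ode_unique]). This gives [U x = max (U 0 - kappa / 4 |x|^2) 0] on all of
[Omega], whether or not the set where [U] is positive is known to be connected.
Total mass [1] forces [U 0 > 0] and [kappa > 0].

The other times follow by dilation ([barenblatt_scaling]). A dilated domain
may fail to cover [Omega]; the density vanishes on the part left out, and
its continuity along rays shows that the parabola is not positive there.

Two facts are needed about Lebesgue measure in several dimensions. One is its
behaviour under dilations; the other is that a convex set of positive measure
contains a ball, which turns identities that hold almost everywhere in [Omega]
into identities at every point of it. Both are proved by induction on the
dimension through slices. *)

Set Implicit Arguments.
Unset Strict Implicit.
Unset Printing Implicit Defensive.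
Import Order.TTheory GRing.Theory Num.Theory.
Import numFieldNormedType.Exports.
Local Open Scope classical_set_scope.
Local Open Scope ring_scope.

(** * Dilations of Lebesgue measure *)

Section dilation.
Context {R : realType}.
Implicit Types (c : R).
Local Notation leb := (@lebesgue_measure R).

Definition mulc c : measurableTypeR R -> measurableTypeR R := fun x => c * x.

Lemma measurable_mulc c : measurable_fun setT (mulc c).
Proof. by apply: measurable_funM; [exact: measurable_cst|exact: measurable_id]. Qed.

HB.instance Definition _ c := isMeasurableFun.Build _ _ _ _ (mulc c) (measurable_mulc c).

(** Both sides are measures in [A], so half-open intervals decide. *)
Lemma lebesgue_measure_dilation c (c0 : 0 < c) (A : set (measurableTypeR R)) :
  measurable A -> (leb A = c%:E * leb ((fun x => (c * x)%R) @^-1` A))%E.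
Proof.
move=> mA.
pose k : {nonneg R} := NngNum (ltW c0).
have -> : (c%:E * leb ((fun x => (c * x)%R) @^-1` A))%E =
  mscale k (pushforward leb (mulc c)) A by [].
apply: lebesgue_measure_unique => //= _ [[a b] _ <-].
rewrite /mscale/= /pushforward /=.
have -> : mulc c @^-1` `]a, b] = `](a / c), (b / c)]%classic.
  by apply/seteqP; split=> x /=; rewrite /mulc !in_itv/= ltr_pdivrMr// ler_pdivlMr// mulrC.
rewrite !lebesgue_measure_itv/= !lte_fin ltr_pM2r ?invr_gt0//.
case: ifPn => _; last by rewrite mule0.
by rewrite -!EFinB -EFinM; congr EFin; field; rewrite gt_eqF.
Qed.

Lemma ge0_integral_dilationR c (f : measurableTypeR R -> \bar R) : 0 < c ->
  measurable_fun setT f -> (forall x, 0 <= f x)%E ->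
  (\int[leb]_x f x = c%:E * \int[leb]_x f (c * x)%R)%E.
Proof.
move=> c0 mf f0; pose k : {nonneg R} := NngNum (ltW c0).
rewrite (@eq_measure_integral _ _ _ setT (mscale k (pushforward leb (mulc c))))//.
  rewrite ge0_integral_mscale//= ge0_integral_pushforward//.
by move=> A mA _ /=; exact: lebesgue_measure_dilation.
Qed.

End dilation.

Section slices.
Context {R : realType} {d : nat}.
Local Notation leb := (@lebesgue_measure R).

Lemma measurable_slice (A : set 'rV[R]_d.+1) (a : R) : measurable A ->
  measurable [set y : 'rV[R]_d | A (rV_cons (a, y))].
Proof.
move=> mA; have mC : measurable (@rV_cons R d @^-1` A).
  by rewrite -[X in measurable X]setTI; exact: measurable_rV_cons.
have := measurable_xsection (a : measurableTypeR R) mC.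
by congr measurable; apply/seteqP; split=> y; rewrite /xsection/= inE.
Qed.

(** Inductions on the dimension go through slices by the first coordinate. *)
Lemma lebesgue_rVS (A : set 'rV[R]_d.+1) :
  (lebesgue_rV A = \int[leb]_a lebesgue_rV [set y : 'rV[R]_d | A (rV_cons (a, y))])%E.
Proof.
rewrite /lebesgue_rV/= /cons_measure /pushforward /product_measure1 /=.
apply: eq_integral => a _ /=; congr (lebesgue_rV_rec R d _).
by apply/seteqP; split=> y; rewrite /xsection/= inE.
Qed.

Lemma measurable_slice_measure (A : set 'rV[R]_d.+1) : measurable A ->
  measurable_fun setT
    (fun a : measurableTypeR R => lebesgue_rV [set y : 'rV[R]_d | A (rV_cons (a, y))]).
Proof.
move=> mA; have mC : measurable (@rV_cons R d @^-1` A).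
  by rewrite -[X in measurable X]setTI; exact: measurable_rV_cons.
apply: eq_measurable_fun (measurable_fun_xsection (@lebesgue_rV R d) mC).
move=> a _ /=; congr lebesgue_rV.
by apply/seteqP; split=> y; rewrite /xsection/= inE.
Qed.

End slices.

Lemma measurable_scale (R : realType) d (c : R) :
  measurable_fun setT (fun x : 'rV[R]_d => c *: x).
Proof.
apply: measurable_rV_valued => i.
rewrite (_ : (fun x : 'rV[R]_d => (c *: x) 0 i) = (fun x => c * x 0 i)).
  by apply: measurable_funM => //; exact: measurable_coord.
by apply/funext => x; rewrite mxE.
Qed.

(** The slice at height [a] of the set of all [x] with [c x] in [A] is the
dilated slice of [A] at height [c a], so the inductive case combines the lower
dimension with the change of variables on the line. *)
Lemma lebesgue_rV_dilation (R : realType) d (c : R) (A : set 'rV[R]_d) :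
  0 < c -> measurable A ->
  (lebesgue_rV A = (c ^+ d)%:E * lebesgue_rV ((fun x => c *: x) @^-1` A))%E.
Proof.
move=> c0; elim: d A => [|d IH] A mA.
  rewrite expr0 mul1e; congr lebesgue_rV.
  by apply/seteqP; split=> x /=; rewrite !(thinmx0 x) scaler0.
have mcA : measurable ((fun x : 'rV[R]_d.+1 => c *: x) @^-1` A).
  by rewrite -[X in measurable X]setTI; exact: measurable_scale.
rewrite !lebesgue_rVS (ge0_integral_dilationR c0)//=; last first.
  exact: measurable_slice_measure.
rewrite exprS EFinM -muleA; congr mule.
rewrite -ge0_integralZl//=; last 2 first.
- exact: (measurable_slice_measure mcA).
- by rewrite lee_fin exprn_ge0// ltW.
apply: eq_integral => a _.
rewrite IH//; last exact: measurable_slice.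
congr (_ * lebesgue_rV _)%E; apply/seteqP.
have E y : rV_cons ((c * a)%R : measurableTypeR R, c *: y) = c *: rV_cons (a : measurableTypeR R, y).
  apply/rowP => i; rewrite [RHS]mxE.
  by have [j ->|->] := unliftP ord0 i; rewrite ?rV_cons0 ?rV_consS ?mxE.
by split=> y /=; rewrite E.
Qed.

(** Infinite values do not spoil the distributivity, as [+oo - +oo] is [-oo] by
convention; this frees the change of variables from integrability assumptions. *)
Lemma gt0_muleB (R : realType) (c : R) (x y : \bar R) : 0 < c ->
  (c%:E * (x - y) = c%:E * x - c%:E * y)%E.
Proof.
move=> c0; have cy : (c%:E * +oo = +oo :> \bar R)%E by rewrite gt0_muley ?lte_fin.
have cNy : (c%:E * -oo = -oo :> \bar R)%E by rewrite gt0_muleNy ?lte_fin.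
case: x y => [x| |] [y| |] /=.
- by rewrite -EFinB -!EFinM -EFinB mulrBr.
all: by rewrite ?cy ?cNy /= ?cy ?cNy /=.
Qed.

Section integral_dilation.
Context {R : realType} {d : nat}.
Local Notation Leb := (@lebesgue_rV R d).

Let scl (c : R) : 'rV[R]_d -> 'rV[R]_d := fun x => c *: x.

HB.instance Definition _ c := isMeasurableFun.Build _ _ _ _ (scl c) (@measurable_scale R d c).

Lemma ge0_integral_dilation c (f : 'rV[R]_d -> \bar R) : 0 < c ->
  measurable_fun setT f -> (forall x, 0 <= f x)%E ->
  (\int[Leb]_x f x = (c ^+ d)%:E * \int[Leb]_x f (c *: x))%E.
Proof.
move=> c0 mf f0; pose k : {nonneg R} := NngNum (exprn_ge0 d (ltW c0)).
rewrite (@eq_measure_integral _ _ _ setT (mscale k (pushforward Leb (scl c))))//.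
  by rewrite ge0_integral_mscale//= ge0_integral_pushforward.
by move=> A mA _ /=; exact: lebesgue_rV_dilation.
Qed.

Lemma integral_dilation c (f : 'rV[R]_d -> \bar R) : 0 < c ->
  measurable_fun setT f ->
  (\int[Leb]_x f x = (c ^+ d)%:E * \int[Leb]_x f (c *: x))%E.
Proof.
move=> c0 mf; rewrite [LHS]integralE [in RHS]integralE.
have -> : (fun x => f (c *: x)) = f \o scl c by [].
have Ep : ((f \o scl c)^\+ = f^\+ \o scl c)%E by rewrite funepos_comp.
have En : ((f \o scl c)^\- = f^\- \o scl c)%E by rewrite funeneg_comp.
rewrite (ge0_integral_dilation c0); [|exact: measurable_funepos|by move=> x; exact: funepos_ge0].
rewrite [X in (_ - X)%E](ge0_integral_dilation c0); [|exact: measurable_funeneg|by move=> x; exact: funeneg_ge0].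
have cd0 : 0 < c ^+ d by rewrite exprn_gt0.
by rewrite [RHS]gt0_muleB// Ep En.
Qed.

(** If the extended integral of [f] is infinite, then so is the dilated one, and
both real integrals are [0]. *)
Lemma Rintegral_dilation c (f : 'rV[R]_d -> R) : 0 < c ->
  measurable_fun setT f ->
  \int[Leb]_x f x = c ^+ d * \int[Leb]_x f (c *: x).
Proof.
move=> c0 mf; rewrite /Rintegral (integral_dilation c0)//; last exact/measurable_EFinP.
have cd0 : 0 < c ^+ d by rewrite exprn_gt0.
by case: integral => [r| |] //=; rewrite ?gt0_muley ?gt0_muleNy ?lte_fin//= mulr0.
Qed.

End integral_dilation.

(** * Convex sets of positive measure *)

Lemma ball_rVP (R : realType) d (c x : 'rV[R]_d) (e : R) : 0 < e ->
  ball c e x <-> forall i, `|c 0 i - x 0 i| < e.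
Proof.
move=> e0; split=> [[_ h] i|h]; first exact: h.
by split=> // i j; rewrite (ord1 i); exact: h.
Qed.

Lemma coord_norm_le (R : realType) d (x : 'rV[R]_d) i : `|x 0 i| <= `|x|.
Proof. by rewrite [leRHS]mx_normrE; exact: (le_bigmax _ _ (0, i)). Qed.

Lemma lebesgue_rV_ball (R : realType) d (c : 'rV[R]_d) (e : R) : 0 < e ->
  lebesgue_rV (ball c e) = ((e *+ 2) ^+ d)%:E.
Proof.
move=> e0.
rewrite (_ : ball c e = [set x | forall i, (ball (c 0 i) e) (x 0 i)]); last first.
  by apply/seteqP; split=> x /= /(ball_rVP _ _ e0).
rewrite (lebesgue_rV_box (A := fun i => ball (c 0 i) e)); last first.
  by move=> i; exact: measurable_ball.
under eq_bigr do rewrite (lebesgue_measure_ball _ (ltW e0)).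
by rewrite prodEFin prodr_const card_ord.
Qed.

Lemma measurable_rV_open (R : realType) d (A : set 'rV[R]_d) : open A -> measurable A.
Proof. exact: sub_sigma_algebra. Qed.

Lemma measurable_rV_closed (R : realType) d (A : set 'rV[R]_d) :
  closed A -> measurable A.
Proof.
move=> cA; rewrite -(setCK A); apply: measurableC; apply: measurable_rV_open.
exact: closed_openC.
Qed.

Definition convex_rV (R : realType) d (A : set 'rV[R]_d) :=
  forall x y (s : R), A x -> A y -> 0 <= s <= 1 -> A (s *: x + (1 - s) *: y).

Lemma convex_setP (R : realType) d (A : set 'rV[R]_d) : convex_set A -> convex_rV A.
Proof.
move=> cA x y s Ax Ay /andP[s0 s1].
pose k : {i01 R} := Itv01 s0 s1.
by have := cA x y k (mem_set Ax) (mem_set Ay); rewrite inE.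
Qed.

Lemma convex_slice (R : realType) d (A : set 'rV[R]_d.+1) (a : R) : convex_rV A ->
  convex_rV [set y : 'rV[R]_d | A (rV_cons (a, y))].
Proof.
move=> cA x y s /= Ax Ay s01; have := cA _ _ s Ax Ay s01; congr A.
apply/rowP => i; rewrite mxE [X in X + _]mxE [X in _ + X]mxE.
have [j ->|->] := unliftP ord0 i; rewrite ?rV_cons0 ?rV_consS ?mxE//=.
by rewrite -mulrDl addrC subrK mul1r.
Qed.

(** A point near the midpoint of the two centres lies on the segment between two
points that are displaced from these centres by the same small vector. *)
Lemma convex_join_ball (R : realType) d (A : set 'rV[R]_d.+1) (a1 a2 : R)
    (c1 c2 : 'rV[R]_d) (e : R) : convex_rV A -> a1 < a2 -> 0 < e ->
  (forall y, ball c1 e y -> A (rV_cons (a1, y))) ->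
  (forall y, ball c2 e y -> A (rV_cons (a2, y))) ->
  exists c e', 0 < e' /\ forall x, ball c e' x -> A x.
Proof.
move=> cA a12 e0 A1 A2.
have a0 : 0 < a2 - a1 by rewrite subr_gt0.
pose D := `|c1 - c2|.
have D0 : 0 <= D by exact: normr_ge0.
(* The first bound keeps the height of a point between [a1] and [a2]; the
   second makes the displacement [z] below smaller than [e]. *)
pose e' := Num.min ((a2 - a1) / 2) (e / (1 + D / (a2 - a1))).
have k0 : 0 < 1 + D / (a2 - a1) by rewrite ltr_pwDl// divr_ge0// ltW.
have e'0 : 0 < e' by rewrite lt_min !divr_gt0.
have e'1 : e' <= (a2 - a1) / 2 by rewrite ge_min lexx.
have e'2 : e' + e' * D / (a2 - a1) <= e.
  have : e' <= e / (1 + D / (a2 - a1)) by rewrite ge_min lexx orbT.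
  by rewrite ler_pdivlMr// mulrDr mulr1 mulrA.
exists (rV_cons ((a1 + a2) / 2, 2^-1 *: (c1 + c2))), e'; split=> // x /(ball_rVP _ _ e'0) xc.
pose a := x 0 0.
pose y : 'rV[R]_d := \row_i x 0 (lift ord0 i).
have Ha : `|(a1 + a2) / 2 - a| < e' by have := xc 0; rewrite rV_cons0.
have Hy i : `|(c1 0 i + c2 0 i) / 2 - y 0 i| < e'.
  by have := xc (lift ord0 i); rewrite rV_consS !mxE mulrC.
(* [a] is the barycentre of [a1] and [a2] with weights [s] and [1 - s] *)
pose s := (a2 - a) / (a2 - a1).
have s2 : `|s - 2^-1| <= e' / (a2 - a1).
  rewrite -[X in `|X|](_ : ((a1 + a2) / 2 - a) / (a2 - a1) = _); last first.
    by rewrite /s; field; rewrite gt_eqF.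
  by rewrite normrM normfV (gtr0_norm a0) ler_pM2r ?invr_gt0// ltW.
have s01 : 0 <= s <= 1.
  have : e' / (a2 - a1) <= 2^-1 by rewrite ler_pdivrMr// mulrC.
  move: s2; rewrite ler_norml; move: (e' / _) => q /andP[]; lra.
pose z := y - (s *: c1 + (1 - s) *: c2).
have Hz i : `|z 0 i| < e.
  have -> : z 0 i = - ((c1 0 i + c2 0 i) / 2 - y 0 i) - (s - 2^-1) * (c1 - c2) 0 i.
    by rewrite !mxE; field.
  apply: le_lt_trans (ler_normB _ _) _; rewrite normrN normrM.
  apply: lt_le_trans e'2.
  apply: ltr_leD => //; rewrite mulrAC; apply: ler_pM => //.
  exact: coord_norm_le.
have -> : x = s *: rV_cons (a1, c1 + z) + (1 - s) *: rV_cons (a2, c2 + z).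
  apply/rowP => i; rewrite mxE [X in _ = X + _]mxE [X in _ = _ + X]mxE.
  have [j ->|->] := unliftP ord0 i; rewrite ?rV_cons0 ?rV_consS ?mxE//=.
    by ring.
  by rewrite -/a /s; field; rewrite gt_eqF.
by apply: cA => //; [apply: A1|apply: A2]; apply/ball_rVP => // i;
   rewrite mxE opprD addNKr normrN.
Qed.

(** A set whose slices are null at all heights but one is null. So there are two
slices of positive measure; by induction each contains a ball, and the convex
hull of two such balls has interior points. *)
Lemma convex_pos_ball (R : realType) d (A : set 'rV[R]_d) :
  measurable A -> convex_rV A -> lebesgue_rV A != 0%E ->
  exists c e, 0 < e /\ forall x, ball c e x -> A x.
Proof.
elim: d A => [|d IH] A mA cA A0.
  have [[x Ax]|nA] := pselect (exists x, A x).
    by exists x, 1; split=> // y _; rewrite (thinmx0 y) -(thinmx0 x).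
  move: A0; rewrite (_ : A = set0) ?measure0 ?eqxx//.
  by apply/seteqP; split=> // x Ax; case: nA; exists x.
pose g (a : R) := lebesgue_rV [set y : 'rV[R]_d | A (rV_cons (a, y))].
have IHg a : g a != 0%E ->
    exists c e, 0 < e /\ forall y, ball c e y -> A (rV_cons (a, y)).
  move=> ga; apply: (IH [set y : 'rV[R]_d | A (rV_cons (a, y))]) => //.
    exact: measurable_slice.
  exact: convex_slice.
suff [a1 [a2 [a12 ga1 ga2]]] : exists a1 a2, [/\ a1 < a2, g a1 != 0%E & g a2 != 0%E].
  have [c1 [e1 [e10 A1]]] := IHg _ ga1.
  have [c2 [e2 [e20 A2]]] := IHg _ ga2.
  apply: (@convex_join_ball _ _ A a1 a2 c1 c2 (Num.min e1 e2)) => //.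
  - by rewrite lt_min e10.
  - by move=> y h; apply: A1; apply: le_ball h; rewrite ge_min lexx.
  - by move=> y h; apply: A2; apply: le_ball h; rewrite ge_min lexx orbT.
apply: contrapT => hno.
have [a0 ha0] : exists a0, forall a, a != a0 -> g a = 0%E.
  have [[a0 ga0]|hn] := pselect (exists a, g a != 0%E); last first.
    by exists 0 => a _; apply: contrapT => /eqP ga; apply: hn; exists a.
  exists a0 => a aa0; apply: contrapT => /eqP ga; apply: hno.
  by case: (ltgtP a a0) aa0 => // h _; [exists a, a0|exists a0, a].
move/eqP: A0; apply; rewrite lebesgue_rVS.
rewrite (@ae_eq_integral _ _ _ (@lebesgue_measure R) setT (cst 0%E))//.
- by rewrite integral0.
- exact: measurable_slice_measure.
exists [set a0]; split; [exact: measurable_set1|exact: lebesgue_measure_set1|].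
move=> a /= h; apply: contrapT => /eqP aa0; apply: h => _.
exact: ha0.
Qed.

Lemma ball_scale_add (R : realType) d (w y b : 'rV[R]_d) (l e : R) : 0 < l -> 0 < e ->
  ball (b + l *: w) (l * e) y -> ball w e (l^-1 *: (y - b)).
Proof.
move=> l0 e0 /(ball_rVP _ _ (mulr_gt0 l0 e0)) h; apply/ball_rVP => // i.
have := h i; rewrite !mxE => h'.
rewrite -(ltr_pM2l l0) -{1}(gtr0_norm l0) -normrM.
by rewrite (_ : l * _ = b 0 i + l * w 0 i - y 0 i)//; field; rewrite gt_eqF.
Qed.

(** Shrinking a ball contained in [A] towards [x] keeps it inside [A]. *)
Lemma convex_ball_dense (R : realType) d (A : set 'rV[R]_d) (w : 'rV[R]_d) (e : R) :
  convex_rV A -> 0 < e -> (forall y, ball w e y -> A y) ->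
  forall x (dlt : R), A x -> 0 < dlt ->
  exists c e', 0 < e' /\ forall y, ball c e' y -> A y /\ ball x dlt y.
Proof.
move=> cA e0 Aw x dlt Ax dlt0.
pose k := e + `|w - x| + 1.
have k0 : 0 < k by rewrite ltr_wpDl// addr_ge0// ltW.
pose l := Num.min 1 (dlt / k).
have l0 : 0 < l by rewrite lt_min ltr01 divr_gt0.
have l1 : l <= 1 by rewrite ge_min lexx.
have lk : l * k <= dlt by rewrite -ler_pdivlMr// ge_min lexx orbT.
exists ((1 - l) *: x + l *: w), (l * e); split; first by rewrite mulr_gt0.
move=> y hy; split.
  have := ball_scale_add l0 e0 hy => /Aw Ay.
  have := cA _ _ l Ay Ax; rewrite (ltW l0) l1 => /(_ isT).
  by rewrite scalerA divff ?gt_eqF// scale1r subrK.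
apply/ball_rVP => // i.
move: hy => /(ball_rVP _ _ (mulr_gt0 l0 e0)) /(_ i).
rewrite !mxE => hy.
have -> : x 0 i - y 0 i = ((1 - l) * x 0 i + l * w 0 i - y 0 i) - l * (w - x) 0 i.
  by rewrite !mxE; ring.
apply: le_lt_trans (ler_normB _ _) _; rewrite normrM (gtr0_norm l0).
apply: lt_le_trans lk.
have -> : l * k = l * e + (l * `|w - x| + l) by rewrite /k; ring.
apply: ltr_leD => //.
apply: (@le_trans _ _ (l * `|w - x|)).
  by rewrite ler_pM2l//; exact: coord_norm_le.
by rewrite lerDl ltW.
Qed.

Lemma ball_scale_sub (R : realType) d (A : set 'rV[R]_d) (w : 'rV[R]_d) (e l : R) :
  convex_rV A -> A 0 -> 0 < e -> (forall y, ball w e y -> A y) -> 0 < l <= 1 ->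
  forall y, ball (l *: w) (l * e) y -> A y.
Proof.
move=> cA A0 e0 Aw /andP[l0 l1] y; rewrite -[l *: w]add0r => /ball_scale_add.
move=> /(_ l0 e0) /Aw; rewrite subr0 => Ay.
have := cA _ _ l Ay A0; rewrite (ltW l0) l1 => /(_ isT).
by rewrite scalerA divff ?gt_eqF// scale1r scaler0 addr0.
Qed.

(** A null set contains no ball, whereas every neighbourhood in [A] of a point of
[A] contains one. *)
Lemma ae_dense_convex (R : realType) d (A : set 'rV[R]_d) (P : set 'rV[R]_d) :
  measurable A -> convex_rV A -> lebesgue_rV A != 0%E ->
  {ae @lebesgue_rV R d, forall x, P x} ->
  forall x (dlt : R), A x -> 0 < dlt -> exists y, [/\ A y, ball x dlt y & P y].
Proof.
move=> mA cA A0 [N [mN N0 PN]] x dlt Ax dlt0.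
have [w [e [e0 Aw]]] := convex_pos_ball mA cA A0.
have [c [e' [e'0 h]]] := convex_ball_dense cA e0 Aw Ax dlt0.
apply: contrapT => hno.
have : (@lebesgue_rV R d (ball c e') <= 0)%E.
  rewrite -N0; apply: le_measure; rewrite ?inE//.
    by apply: measurable_rV_open; exact: ball_open.
  move=> y /h[Ay xy]; apply: PN => Py; apply: hno; exists y; split=> //.
by rewrite lebesgue_rV_ball// leNgt lte_fin exprn_gt0// pmulrn_lgt0.
Qed.

(** * Closure properties of smooth functions *)

Section smooth_theory.
Context {R : realType}.

(** Smoothness is the largest property that implies differentiability and is
stable under directional derivatives. The closure lemmas below exhibit such
properties. *)
Lemma smooth_coind (V W : normedModType R) (C : (V -> W) -> Prop) :
  (forall f, C f -> (forall x, differentiable f x) /\ forall v, C ('D_v f)) ->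
  forall f, C f -> smooth f.
Proof.
move=> HC f Cf vs x; suff: C (iter_derive vs f) by move=> /HC[].
by elim: vs => //= v vs IH; exact: (HC _ IH).2.
Qed.

Lemma smooth_differentiable (V W : normedModType R) (f : V -> W) x :
  smooth f -> differentiable f x.
Proof. by move=> /(_ [::] x). Qed.

Lemma smooth_derive (V W : normedModType R) (f : V -> W) v :
  smooth f -> smooth ('D_v f).
Proof.
by move=> sf vs x; have := sf (rcons vs v) x; rewrite /iter_derive foldr_rcons.
Qed.

Lemma smooth_continuous (V W : normedModType R) (f : V -> W) :
  smooth f -> continuous f.
Proof. by move=> sf x; exact/differentiable_continuous/smooth_differentiable. Qed.

(** Products alone are not stable under derivatives, because of the Leibniz rule;
the algebra generated by smooth functions is. *)
Inductive smooth_alg (V : normedModType R) : (V -> R) -> Prop :=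
| smooth_alg_base f : smooth f -> smooth_alg f
| smooth_algD f g : smooth_alg f -> smooth_alg g -> smooth_alg (f \+ g)
| smooth_algM f g : smooth_alg f -> smooth_alg g -> smooth_alg (f \* g).

Lemma smooth_alg_smooth (V : normedModType R) (f : V -> R) :
  smooth_alg f -> smooth f.
Proof.
apply: smooth_coind => {}f; elim=> {f}.
- move=> f sf; split=> [x|v]; first exact: smooth_differentiable.
  by apply: smooth_alg_base; exact: smooth_derive.
- move=> f g sf [df Df] sg [dg Dg]; split=> [x|v]; first exact: differentiableD.
  rewrite (_ : 'D_v _ = 'D_v f \+ 'D_v g); first exact: smooth_algD.
  by apply/funext => x; rewrite (@deriveD _ _ _ f g)//; exact: diff_derivable.
- move=> f g sf [df Df] sg [dg Dg]; split=> [x|v].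
    exact: (@differentiableM _ _ f g).
  rewrite (_ : 'D_v _ = (f \* 'D_v g) \+ (g \* 'D_v f)).
    by apply: smooth_algD; apply: smooth_algM.
  by apply/funext => x; rewrite (@deriveM _ _ f g)//; exact: diff_derivable.
Qed.

Lemma smoothD (V : normedModType R) (f g : V -> R) :
  smooth f -> smooth g -> smooth (fun x => f x + g x).
Proof.
move=> sf sg; apply: (@smooth_alg_smooth _ (f \+ g)).
by apply: smooth_algD; exact: smooth_alg_base.
Qed.

Lemma smoothM (V : normedModType R) (f g : V -> R) :
  smooth f -> smooth g -> smooth (fun x => f x * g x).
Proof.
move=> sf sg; apply: (@smooth_alg_smooth _ (f \* g)).
by apply: smooth_algM; exact: smooth_alg_base.
Qed.

Lemma smooth_cst (V W : normedModType R) (c : W) : smooth (fun _ : V => c).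
Proof.
apply: (@smooth_coind _ _ (fun f => exists c, f = fun=> c)); last by exists c.
move=> _ [k ->]; split=> [x|v]; first exact: differentiable_cst.
by exists 0; apply/funext => x; rewrite (derive_cst k).
Qed.

(** A constant derivative is all that matters about an affine map: composition
with it turns directional derivatives into directional derivatives. *)
Definition affine_map (V V' : normedModType R) (l : V -> V') :=
  (forall x, differentiable l x) /\ forall v, exists a, forall x, 'D_v l x = a.

Lemma affine_smooth (V V' : normedModType R) (l : V -> V') :
  affine_map l -> smooth l.
Proof.
move=> al.
apply: (@smooth_coind _ _ (fun f => affine_map f)) => // f [df Df]; split=> // v.
have [a fa] := Df v; have -> : 'D_v f = cst a by apply/funext.
split=> [x|w]; first exact: differentiable_cst.
by exists 0 => x; rewrite derive_cst.
Qed.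

Lemma smooth_comp_affine (V V' W : normedModType R) (l : V -> V') (g : V' -> W) :
  affine_map l -> smooth g -> smooth (fun x => g (l x)).
Proof.
move=> [dl Dl] sg.
apply: (@smooth_coind _ _ (fun f => exists2 g, smooth g & f = fun x => g (l x))); last by exists g.
move=> _ [h sh ->].
have dh x : differentiable (h \o l) x.
  by apply: differentiable_comp => //; exact: smooth_differentiable.
split=> // v; have [a Ha] := Dl v; exists ('D_a h); first exact: smooth_derive.
apply/funext => x; rewrite (deriveE v (dh x)) diff_comp//; last exact: smooth_differentiable.
by rewrite /= -(deriveE v (dl x)) Ha deriveE//; exact: smooth_differentiable.
Qed.

Lemma smooth_prod (V : normedModType R) I (s : seq I) (F : I -> V -> R) :
  (forall i, smooth (F i)) -> smooth (fun x => \prod_(i <- s) F i x).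
Proof.
move=> sF; elim: s => [|i s IH].
  rewrite (_ : (fun _ => _) = fun=> 1); first exact: smooth_cst.
  by apply/funext => x; rewrite big_nil.
rewrite (_ : (fun _ => _) = fun x => F i x * \prod_(j <- s) F j x); first exact: smoothM.
by apply/funext => x; rewrite big_cons.
Qed.

Lemma smooth_sum (V : normedModType R) I (s : seq I) (F : I -> V -> R) :
  (forall i, smooth (F i)) -> smooth (fun x => \sum_(i <- s) F i x).
Proof.
move=> sF; elim: s => [|i s IH].
  rewrite (_ : (fun _ => _) = fun=> 0); first exact: smooth_cst.
  by apply/funext => x; rewrite big_nil.
rewrite (_ : (fun _ => _) = fun x => F i x + \sum_(j <- s) F j x); first exact: smoothD.
by apply/funext => x; rewrite big_cons.
Qed.

Lemma linear_affine_map (V V' : normedModType R) (l : {linear V -> V'}) :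
  continuous l -> affine_map l.
Proof.
move=> cl; have dl x : differentiable l x by exact: linear_differentiable.
by split=> // v; exists (l v) => x; rewrite deriveE// diff_lin.
Qed.

Lemma affine_fst (V V' : normedModType R) : affine_map (@fst V V').
Proof. by apply: linear_affine_map => x; exact: cvg_fst. Qed.

Lemma affine_snd (V V' : normedModType R) : affine_map (@snd V V').
Proof. by apply: linear_affine_map => x; exact: cvg_snd. Qed.

Lemma affine_coord d (i : 'I_d) : affine_map (fun x : 'rV[R]_d => x 0 i).
Proof.
have dc x : differentiable (fun x : 'rV[R]_d => x 0 i) x by exact: differentiable_coord.
split=> // v; exists (v 0 i) => x.
rewrite deriveE//.
have lc : linear (fun x : 'rV[R]_d => x 0 i) by move=> a y z; rewrite !mxE.
pose L : {linear 'rV[R]_d -> R} := HB.pack (fun x : 'rV[R]_d => x 0 i) (GRing.isLinear.Build _ _ _ _ _ lc).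
rewrite (_ : (fun x : 'rV[R]_d => x 0 i) = L)// diff_lin//.
exact: coord_continuous.
Qed.

Lemma affine_shift (V V' : normedModType R) (l : V -> V') (k : R) (c : V') :
  affine_map l -> affine_map (fun x => k *: l x + c).
Proof.
move=> [dl Dl].
have d1 x : differentiable (k \*: l) x by exact: differentiableZ.
have d2 x : differentiable (fun _ : V => c) x by exact: differentiable_cst.
have d3 x : differentiable (fun x => k *: l x + c) x by exact: (@differentiableD _ _ _ (k \*: l)).
split=> // v; have [a Ha] := Dl v; exists (k *: a) => x.
rewrite (@deriveD _ _ _ (k \*: l) (fun _ => c)); try exact: diff_derivable.
by rewrite deriveZ ?derive_cst ?addr0 ?Ha//; exact: diff_derivable.
Qed.

Lemma smooth_mx (V : normedModType R) d (f : V -> 'rV[R]_d) :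
  (forall j, smooth (fun x => f x 0 j)) -> smooth f.
Proof.
pose C (g : V -> 'rV[R]_d) := forall j, smooth (fun x => g x 0 j).
move=> Cf; apply: (@smooth_coind V 'rV[R]_d C) Cf => {}f sf.
have df x : differentiable f x.
  have -> : f = \sum_(j < d) (fun x => f x 0 j *: delta_mx 0 j).
    apply/funext => y; rewrite [LHS]row_sum_delta fct_sumE.
    by apply: eq_bigr.
  apply: differentiable_sum => j.
  by apply: differentiableZl; exact: smooth_differentiable.
split=> // v j.
rewrite (_ : (fun _ => _) = 'D_v (fun x => f x 0 j)); first exact: smooth_derive.
apply/funext => x; rewrite derive_mx ?mxE//; exact: diff_derivable.
Qed.

End smooth_theory.

(** * Bump functions *)

(** For functions known through estimates only, or defined by cases. *)
Lemma is_derive_quadratic (R : realType) (f : R -> R) (x c C dlt : R) : 0 < dlt ->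
  (forall h, `|h| < dlt -> `|f (x + h) - f x - c * h| <= C * h ^+ 2) ->
  is_derive x 1 f c.
Proof.
move=> dlt0 fC.
have fx : h^-1 *: (f (h *: 1 + x) - f x) @[h --> 0^'] --> c.
  apply/cvgrPdist_le => e e0.
  pose K := `|C| + 1.
  have K0 : 0 < K by rewrite ltr_wpDl.
  near=> h.
  have h0 : h != 0 by near: h; exact: nbhs_dnbhs_neq.
  have hd : `|h| < dlt by near: h; apply: dnbhs0_lt.
  have he : `|h| < e / K by near: h; apply: dnbhs0_lt; rewrite divr_gt0.
  rewrite -(ler_pM2l (_ : 0 < `|h|)) ?normr_gt0// -normrM.
  rewrite [X in `|X|](_ : _ = - (f (x + h) - f x - c * h)); last first.
    by rewrite [h *: 1]mulr1 [h + x]addrC /GRing.scale/=; field.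
  rewrite normrN; apply: le_trans (fC _ hd) _.
  apply: (@le_trans _ _ (K * `|h| ^+ 2)).
    rewrite -normrX (ger0_norm (sqr_ge0 h)) ler_wpM2r ?sqr_ge0//.
    by rewrite (le_trans (ler_norm C))// lerDl.
  rewrite expr2 mulrCA ler_wpM2l// mulrC -ler_pdivlMr//; exact: ltW.
apply: DeriveDef; last exact/cvg_lim.
by apply/cvg_ex; exists c.
Unshelve. all: by end_near. Qed.

(** The polynomial factor makes the family stable under derivatives. *)
Definition bump_fun (R : realType) (P : {poly R}) (x : R) : R :=
  if 0 < x then P.[x^-1] * expR (- x^-1) else 0.

(** [expR y] dominates [y ^+ (size P).+2] up to a factor, while [P.[y]] is of
order [y ^+ size P]; the two spare powers make the derivative at [0] vanish. *)
Lemma bump_fun_bound (R : realType) (P : {poly R}) :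
  exists C, forall h : R, `|h| < 1 -> `|bump_fun P h| <= C * h ^+ 2.
Proof.
pose S := \sum_(i < size P) `|P`_i|.
have S0 : 0 <= S by apply: sumr_ge0.
pose n := (size P).+1.
exists (S * n.+1`!%:R) => h h1; rewrite /bump_fun; case: ifPn => h0; last first.
  by rewrite normr0 mulr_ge0 ?sqr_ge0// mulr_ge0.
have y0 : 0 < h^-1 by rewrite invr_gt0.
have y1 : 1 <= h^-1 by rewrite invf_ge1// ltW// -(gtr0_norm h0).
set y := h^-1 in y0 y1 *.
have Py : `|P.[y]| <= S * y ^+ n.-1.
  rewrite horner_coef mulr_suml; apply: le_trans (ler_norm_sum _ _ _) _.
  apply: ler_sum => i _; rewrite normrM ler_wpM2l// ger0_norm; last by rewrite exprn_ge0// ltW.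
  by rewrite ler_weXn2l// ltnW.
have ey : y ^+ n.+1 / n.+1`!%:R <= expR y.
  by apply: le_trans (expR_ge1Dxn n (ltW y0)); rewrite lerDr.
rewrite normrM (ger0_norm (expR_ge0 _)) expRN.
have F0 : 0 < n.+1`!%:R :> R by rewrite ltr0n fact_gt0.
have ey' : (expR y)^-1 <= n.+1`!%:R / y ^+ n.+1.
  rewrite -[leRHS]invrK lef_pV2 ?posrE ?expR_gt0//; last first.
    by rewrite invr_gt0 divr_gt0// exprn_gt0.
  by rewrite invf_div.
have H : `|P.[y]| / expR y <= S * y ^+ n.-1 * (n.+1`!%:R / y ^+ n.+1).
  by apply: ler_pM => //; rewrite invr_ge0 expR_ge0.
apply: le_trans H _.
have hy : h = y^-1 by rewrite invrK.
rewrite hy /n /= !exprSr expr0 mul1r; move: (_%:R) (y ^+ size P) (exprn_gt0 (size P) y0) => F z z0.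
rewrite le_eqVlt; apply/orP; left; apply/eqP; field.
by rewrite !gt_eqF.
Qed.

(** With [y = x^-1] one has [d y / d x = - y ^+ 2], which explains the new
polynomial. *)
Lemma is_derive_bump_fun (R : realType) (P : {poly R}) (x : R) :
  is_derive x 1 (bump_fun P) (bump_fun ((P - P^`()) * 'X^2) x).
Proof.
have [C HC] := bump_fun_bound P.
case: (ltgtP x 0) => x0.
- rewrite {2}/bump_fun ltNge (ltW x0)/=.
  apply: (@near_eq_is_derive _ _ _ (cst 0)); rewrite ?oner_eq0//.
  near=> z; rewrite /bump_fun ltNge (ltW (_ : z < 0))//.
  by near: z; exact: lt_nbhsl.
- rewrite {2}/bump_fun x0.
  apply: (@near_eq_is_derive R R R (fun z : R => P.[z^-1] * expR (- z^-1))); rewrite ?oner_eq0//.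
    near=> z; rewrite /bump_fun (_ : 0 < z)//.
    by near: z; exact: lt_nbhsr.
  have xn0 : x != 0 by rewrite gt_eqF.
  have dV : is_derive x 1 (fun z : R => z^-1) (- x ^- 2).
    by apply: is_derive_eq; [exact: is_deriveV|rewrite scaler1].
  have dN : is_derive x 1 (fun z : R => - z^-1) (- - x ^- 2) by exact: is_deriveN.
  have dE : is_derive x 1 (fun z : R => expR (- z^-1)) (expR (- x^-1) * - - x ^- 2).
    exact: (is_derive1_comp (is_derive_expR _) dN).
  have dP : is_derive x 1 (fun z : R => P.[z^-1]) (P^`().[x^-1] * - x ^- 2).
    exact: (is_derive1_comp (is_derive_poly _ _) dV).
  apply: (is_derive_eq (is_deriveM dP dE)).
  rewrite !hornerE /GRing.scale/=.
  by field.
- rewrite x0 {2}/bump_fun ltxx.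
  apply: (@is_derive_quadratic _ _ _ _ C 1) => // h h1.
  by rewrite add0r {2}/bump_fun ltxx subr0 mul0r subr0; exact: HC.
Unshelve. all: by end_near. Qed.

Lemma bump_fun_smooth (R : realType) (P : {poly R}) : smooth (bump_fun P : R -> R).
Proof.
pose C (f : R -> R) := exists Q : {poly R}, f = bump_fun Q.
apply: (@smooth_coind R R R C); last by exists P.
move=> _ [Q ->].
have dQ x : differentiable (bump_fun Q) x.
  by apply/derivable1_diffP; have [] := is_derive_bump_fun Q x.
split=> // v; exists (v *: ((Q - Q^`()) * 'X^2)); apply/funext => x.
have -> : 'D_v (bump_fun Q) x = v * 'D_1 (bump_fun Q) x.
  by rewrite !deriveE// -[X in 'd _ _ X]mulr1 linearZ.
rewrite (@derive_val _ _ _ _ _ _ _ (is_derive_bump_fun Q x)) /bump_fun.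
by case: ifPn => _; rewrite ?mulr0// hornerZ mulrA.
Qed.

Definition bump1 (R : realType) (x : R) : R := bump_fun 1%:P x.

Lemma bump1_gt0 (R : realType) (x : R) : 0 < x -> 0 < bump1 x.
Proof. by move=> x0; rewrite /bump1 /bump_fun x0 hornerC mul1r expR_gt0. Qed.

Lemma bump1_eq0 (R : realType) (x : R) : x <= 0 -> bump1 x = 0.
Proof. by move=> x0; rewrite /bump1 /bump_fun ltNge x0. Qed.

Lemma bump1_ge0 (R : realType) (x : R) : 0 <= bump1 x.
Proof. by case: (ltP 0 x) => [/bump1_gt0/ltW//|/bump1_eq0 ->]. Qed.

Definition itv_bump (R : realType) (c e x : R) : R := bump1 (e + (x - c)) * bump1 (e - (x - c)).

Lemma itv_bump_gt0 (R : realType) (c e x : R) : `|x - c| < e -> 0 < itv_bump c e x.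
Proof. by rewrite ltr_norml => /andP[h1 h2]; rewrite mulr_gt0// bump1_gt0//; lra. Qed.

Lemma itv_bump_eq0 (R : realType) (c e x : R) : e <= `|x - c| -> itv_bump c e x = 0.
Proof.
rewrite /itv_bump ler_normr => /orP[h|h]; [rewrite [X in _ * X]bump1_eq0 ?mulr0//|rewrite bump1_eq0 ?mul0r//]; lra.
Qed.

Lemma itv_bump_ge0 (R : realType) (c e x : R) : 0 <= itv_bump c e x.
Proof. by rewrite mulr_ge0// bump1_ge0. Qed.

Lemma smooth_itv_bump (R : realType) (V : normedModType R) (l : V -> R) (c e : R) : affine_map l ->
  smooth (fun x => itv_bump c e (l x)).
Proof.
move=> al.
have s1 : smooth (@bump1 R : R -> R) by exact: bump_fun_smooth.
apply: smoothM.
  have := smooth_comp_affine (affine_shift 1 (e - c) al) s1.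
  by congr smooth; apply/funext => x; congr (bump1 _); rewrite scale1r; ring.
have := smooth_comp_affine (affine_shift (-1) (e + c) al) s1.
by congr smooth; apply/funext => x; congr (bump1 _); rewrite scaleN1r; ring.
Qed.

Definition bump_rV (R : realType) d (c : 'rV[R]_d) (e : R) (x : 'rV[R]_d) : R :=
  \prod_(i < d) itv_bump (c 0 i) e (x 0 i).

Lemma smooth_bump_rV (R : realType) d (c : 'rV[R]_d) (e : R) : smooth (bump_rV c e).
Proof. by apply: smooth_prod => i; apply: smooth_itv_bump; exact: affine_coord. Qed.

Lemma bump_rV_ge0 (R : realType) d (c : 'rV[R]_d) (e : R) (x : 'rV[R]_d) : 0 <= bump_rV c e x.
Proof. by apply: prodr_ge0 => i _; exact: itv_bump_ge0. Qed.

Lemma bump_rV_gt0 (R : realType) d (c : 'rV[R]_d) (e : R) (x : 'rV[R]_d) :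
  (forall i, `|x 0 i - c 0 i| < e) -> 0 < bump_rV c e x.
Proof. by move=> h; apply: prodr_gt0 => i _; exact: itv_bump_gt0. Qed.

Lemma bump_rV_eq0 (R : realType) d (c : 'rV[R]_d) (e : R) (x : 'rV[R]_d) i :
  e <= `|x 0 i - c 0 i| -> bump_rV c e x = 0.
Proof. by move=> h; rewrite /bump_rV (bigD1 i)//= itv_bump_eq0// mul0r. Qed.

(** * Moments of dilated test functions *)

(** The derivative [x . grad f] along the position field. *)
Definition radial (R : realType) d (f : 'rV[R]_d -> R) (x : 'rV[R]_d) : R := 'D_x f x.

Definition supported (R : realType) d (K : R) (f : 'rV[R]_d -> R) :=
  forall x, K < `|x| -> f x = 0.

Lemma smooth_radial (R : realType) d (f : 'rV[R]_d -> R) : smooth f -> smooth (radial f).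
Proof.
move=> sf.
have -> : radial f = fun x => \sum_(j < d) x 0 j * 'D_(delta_mx 0 j) f x.
  apply/funext => x; rewrite /radial deriveE; last exact: smooth_differentiable.
  transitivity ('d f x (\sum_(j < d) x 0 j *: delta_mx 0 j)); first by rewrite -row_sum_delta.
  rewrite linear_sum; apply: eq_bigr => j _.
  by rewrite linearZ deriveE//; exact: smooth_differentiable.
apply: smooth_sum => j; apply: smoothM; first exact/affine_smooth/affine_coord.
exact: smooth_derive.
Qed.

Lemma supported_radial (R : realType) d (K : R) (f : 'rV[R]_d -> R) :
  supported K f -> supported K (radial f).
Proof.
move=> sf x Kx; rewrite /radial.
have -> : 'D_x f x = 'D_x (cst (0 : R)) x.
  apply: near_eq_derive.
  have : nbhs x [set y : 'rV[R]_d | K < `|y|].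
    apply: open_nbhs_nbhs; split => //.
    by apply: (@open_comp _ _ (fun y : 'rV[R]_d => `|y|) [set r : R | K < r]) => [y _|]; [exact: norm_continuous|exact: open_gt].
  by apply: filterS => y; exact: sf.
exact: derive_cst.
Qed.

Lemma measurable_rV_continuous (R : realType) d (f : 'rV[R]_d -> R) :
  continuous f -> measurable_fun setT f.
Proof.
move=> cf; apply: (measurability _ (RGenOpens.measurableE R)) => _ [_ [a [b ->]] <-].
rewrite setTI; apply: measurable_rV_open.
by apply: open_comp; [move=> x _; exact: cf|exact: interval_open].
Qed.

Lemma continuous_supported_bounded (R : realType) d (K : R) (f : 'rV[R]_d -> R) :
  continuous f -> supported K f -> exists2 M, 0 <= M & forall x, `|f x| <= M.
Proof.
move=> cf sf.
pose A := [set x : 'rV[R]_d | `|x| <= K].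
have cA : compact A.
  apply: bounded_closed_compact.
    by exists K; split; [exact: num_real|move=> M KM x /le_trans; apply; exact: ltW].
  apply: (@closed_comp _ _ (fun y : 'rV[R]_d => `|y|) [set r : R | r <= K]) => [y _|]; [exact: norm_continuous|exact: closed_le].
have [x0|hA] := pselect (A !=set0); last first.
  exists 0 => // x; rewrite sf ?normr0//.
  by rewrite ltNge; apply/negP => h; apply: hA; exists x.
have cf' : {within A, continuous (fun x => `|f x|)}.
  apply: continuous_subspaceT => x.
  by apply: (@continuous_comp _ _ _ f (fun y : R => `|y|)); [exact: cf|exact: norm_continuous].
have [c _ Hc] := EVT_max_rV x0 cA cf'.
exists `|f c| => // x; case: (leP `|x| K) => h; first by apply: Hc; rewrite inE.
by rewrite sf// normr0.
Qed.

Lemma integrable_bounded_supported (R : realType) d (M K : R) (f : 'rV[R]_d -> R) :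
  measurable_fun setT f -> (forall x, `|f x| <= M) -> supported K f ->
  (@lebesgue_rV R d).-integrable setT (EFin \o f).
Proof.
move=> mf fM fK.
pose r := `|K| + 1.
have r0 : 0 < r by rewrite ltr_wpDl.
have mB : measurable (ball (0 : 'rV[R]_d) r) by apply: measurable_rV_open; exact: ball_open.
apply: (@le_integrable _ _ _ _ setT _ (EFin \o f) (fun x => M%:E * (\1_(ball (0 : 'rV[R]_d) r) x)%:E)%E) => //.
- exact/measurable_EFinP.
- move=> x _; rewrite /= lee_fin indicE.
  case: (boolP (x \in _)) => xb; first by rewrite mulr1 (le_trans (fM _))// ler_norm.
  rewrite fK ?normr0//.
  move: xb; rewrite notin_setE -ball_normE /= sub0r normrN => /negP; rewrite -leNgt.
  by apply: lt_le_trans; rewrite /r (le_lt_trans (ler_norm K))// ltrDl.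
- apply: integrableZl => //; apply/integrableP; split.
    exact/measurable_EFinP/measurable_indic.
  under eq_integral do rewrite gee0_abs// ?lee_fin//.
  rewrite integral_indic// setIT.
  suff : (lebesgue_rV (ball (0%R : 'rV[R]_d) r) < +oo)%E by [].
  by rewrite lebesgue_rV_ball// ltry.
Qed.

Definition locally_bounded (R : realType) d (h : 'rV[R]_d -> R) :=
  forall K, exists2 M, 0 <= M & forall x, `|x| <= K -> `|h x| <= M.

Lemma integrable_supportedM (R : realType) d (K : R) (f h : 'rV[R]_d -> R) :
  continuous f -> supported K f -> measurable_fun setT h -> locally_bounded h ->
  (@lebesgue_rV R d).-integrable setT (EFin \o (fun x => f x * h x)).
Proof.
move=> cf sf mh bh.
have [M M0 fM] := continuous_supported_bounded cf sf.
have [N N0 hN] := bh K.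
apply: (@integrable_bounded_supported _ _ (M * N) K).
- by apply: measurable_funM => //; exact: measurable_rV_continuous.
- move=> x; case: (leP `|x| K) => xK; last by rewrite sf// mul0r normr0 mulr_ge0.
  by rewrite normrM ler_pM//; exact: hN.
- by move=> x xK; rewrite sf// mul0r.
Qed.

Lemma continuous_dilation (R : realType) d (f : 'rV[R]_d -> R) (s : R) :
  continuous f -> continuous (fun y : 'rV[R]_d => f (s *: y)).
Proof. by move=> cf x; apply: continuous_comp; [exact: scaler_continuous|exact: cf]. Qed.

Section dilated_moment.
Context {R : realType} {d : nat}.
Local Notation Leb := (@lebesgue_rV R d).
Variables (K : R) (f h : 'rV[R]_d -> R).
Hypotheses (sf : smooth f) (Kf : supported K f) (mh : measurable_fun setT h)
  (bh : locally_bounded h).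

(** In the coordinates [x = s y] the integrals of test functions against the
moving density take this form, with a fixed weight [h]. *)
Definition dilated_moment (g : 'rV[R]_d -> R) (s : R) := \int[Leb]_y (g (s *: y) * h y).

Lemma supported_dilation (g : 'rV[R]_d -> R) (s : R) : 0 < s ->
  supported K g -> supported (K / s) (fun y => g (s *: y)).
Proof.
move=> s0 Kg x; rewrite ltr_pdivrMr// mulrC => h1; apply: Kg.
by rewrite normrZ gtr0_norm.
Qed.

Lemma is_derive_dilation (y : 'rV[R]_d) (s : R) : s != 0 ->
  is_derive s 1 (fun s => f (s *: y)) (s^-1 * radial f (s *: y)).
Proof.
move=> s0.
have dl : is_diff s (fun s : R => s *: y) (fun t => t *: y).
  exact: is_diff_scalel.
have df : differentiable f (s *: y) by exact: smooth_differentiable.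
have dfl : differentiable (f \o (fun s : R => s *: y)) s by apply: differentiable_comp.
apply: DeriveDef; first exact/derivable1_diffP.
rewrite (deriveE (1 : R^o) dfl) diff_comp//= diff_val scale1r /radial deriveE//.
by rewrite linearZ /GRing.scale/= mulrA mulVf// mul1r.
Qed.

Lemma dilated_moment_integrable (s : R) : 0 < s ->
  Leb.-integrable setT (EFin \o (fun y => f (s *: y) * h y)).
Proof.
move=> s0; apply: (@integrable_supportedM _ _ (K / s) (fun y => f (s *: y))) => //.
  exact/continuous_dilation/smooth_continuous.
exact: supported_dilation.
Qed.

(** Differentiate under the integral: the derivative of [f (s y)] in [s] is the
radial derivative of [f] at [s y], divided by [s]. *)
Lemma is_derive_dilated_moment (s : R) : 0 < s ->
  is_derive s 1 (dilated_moment f) (s^-1 * dilated_moment (radial f) s).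
Proof.
move=> s0.
have [M M0 fM] := continuous_supported_bounded (smooth_continuous (smooth_radial sf)) (supported_radial Kf).
(* For [t > s / 2], [f (t *: y)] vanishes when [y] is outside the ball of
   radius [K']. *)
pose K' := `|K| * (2 / s).
have [N N0 hN] := bh K'.
have r0 : 0 < K' + 1 by rewrite ltr_wpDl// mulr_ge0// divr_ge0// ltW.
pose G (y : 'rV[R]_d) := (2 / s * M * N) * \1_(ball (0 : 'rV[R]_d) (K' + 1)) y.
have mB : measurable (ball (0 : 'rV[R]_d) (K' + 1)) by apply: measurable_rV_open; exact: ball_open.
have c0 : 0 <= 2 / s * M * N by rewrite !mulr_ge0// invr_ge0 ltW.
have G0 y : 0 <= G y by rewrite mulr_ge0.
have s2 : `](s / 2), (s * 2)[%classic s by rewrite /= in_itv/=; apply/andP; split; lra.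
have d1 x y : `](s / 2), (s * 2)[%classic x ->
    is_derive x 1 (fun t => f (t *: y) * h y) (x^-1 * radial f (x *: y) * h y).
  rewrite /= in_itv/= => /andP[x1 x2].
  have x0 : x != 0 by rewrite gt_eqF// (lt_trans _ x1)// divr_gt0.
  have H := is_derive_dilation y x0.
  apply: (is_derive_eq (is_deriveM H (is_derive_cst (h y) x 1))).
  by rewrite scaler0 add0r /GRing.scale/= mulrC.
have iF x : `](s / 2), (s * 2)[%classic x ->
    Leb.-integrable setT (EFin \o (fun y => f (x *: y) * h y)).
  rewrite /= in_itv/= => /andP[x1 x2]; apply: dilated_moment_integrable.
  by rewrite (lt_trans _ x1)// divr_gt0.
have iG : Leb.-integrable setT (EFin \o G).
  apply: (@integrable_bounded_supported _ _ (2 / s * M * N) (K' + 1)).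
  - by apply: measurable_funM => //; exact: measurable_indic.
  - move=> x; rewrite ger0_norm// /G indicE; case: (_ \in _); rewrite ?mulr1 ?mulr0//.
  - move=> x xK; rewrite /G indicE memNset ?mulr0//.
    by rewrite -ball_normE/= sub0r normrN => /(lt_trans xK); rewrite ltxx.
have Gub x y : `](s / 2), (s * 2)[%classic x -> setT y ->
    `|partial1of2 (fun t y => f (t *: y) * h y) x y| <= G y.
  move=> Ix _; rewrite partial1of2E (@derive_val _ _ _ _ _ _ _ (d1 x y Ix)).
  move: Ix; rewrite /= in_itv/= => /andP[x1 x2].
  have x0 : 0 < x by rewrite (lt_trans _ x1)// divr_gt0.
  rewrite /G indicE; case: (boolP (y \in _)) => yB.
    rewrite mulr1; case: (leP `|y| K') => yK.
      rewrite !normrM ler_pM ?mulr_ge0 ?hN// ler_pM//.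
      rewrite normfV gtr0_norm// -[leRHS]invrK invf_div lef_pV2 ?posrE ?divr_gt0//.
      exact: ltW.
    rewrite (_ : radial f _ = 0) ?mulr0 ?mul0r ?normr0//.
    apply: (supported_radial Kf); rewrite normrZ gtr0_norm//.
    apply: le_lt_trans (ler_norm K) _.
    move: yK; rewrite /K' mulrA ltr_pdivrMr// => yK.
    have : `|y| * (s / 2) <= x * `|y| by rewrite mulrC ler_wpM2r// ltW.
    by apply: lt_le_trans; rewrite mulrA ltr_pdivlMr.
  rewrite (_ : radial f _ = 0) ?mulr0 ?mul0r ?normr0//.
  apply: (supported_radial Kf); rewrite normrZ gtr0_norm//.
  move: yB; rewrite notin_setE -ball_normE /= sub0r normrN => /negP; rewrite -leNgt => yB.
  have yK : K' < `|y| by rewrite (lt_le_trans _ yB)// ltrDl.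
  apply: le_lt_trans (ler_norm K) _.
  move: yK; rewrite /K' mulrA ltr_pdivrMr// => yK.
  have : `|y| * (s / 2) <= x * `|y| by rewrite mulrC ler_wpM2r// ltW.
  by apply: lt_le_trans; rewrite mulrA ltr_pdivlMr.
have dF x y : `](s / 2), (s * 2)[%classic x -> setT y ->
    derivable ((fun t y => f (t *: y) * h y) ^~ y) x 1.
  by move=> Ix _; have [] := d1 x y Ix.
apply: DeriveDef.
  exact: (@derivable_under_integral _ _ _ Leb (fun t y => f (t *: y) * h y) setT measurableT s _ _ s2 iF dF G G0 iG Gub).
rewrite -derive1E.
rewrite (@differentiation_under_integral _ _ _ Leb (fun t y => f (t *: y) * h y) setT measurableT s _ _ s2 iF dF G G0 iG Gub).
under eq_Rintegral do rewrite partial1of2E (@derive_val _ _ _ _ _ _ _ (d1 s _ s2)) -mulrA.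
rewrite RintegralZl//.
apply: (@integrable_supportedM _ _ (K / s) (fun y => radial f (s *: y))) => //.
  exact/continuous_dilation/smooth_continuous/smooth_radial.
exact/supported_dilation/supported_radial.
Qed.

End dilated_moment.

(** * Localisation in time *)

Section time_localisation.
Context {R : realType}.
Local Notation leb := (@lebesgue_measure R).

Lemma affine_id : affine_map (fun x : R => x).
Proof. by split=> // v; exists v => x; rewrite derive_id. Qed.

Lemma smooth_itv_bump_id (c e : R) : smooth (itv_bump c e : R -> R).
Proof. exact: (@smooth_itv_bump R R (fun x : R => x) c e affine_id). Qed.

Lemma continuous_itv_bump (c e : R) : continuous (itv_bump c e : R -> R).
Proof. exact/smooth_continuous/smooth_itv_bump_id. Qed.

Lemma derive_itv_bump_eq0 (c e t : R) : e < `|t - c| -> 'D_1 (itv_bump c e : R -> R) t = 0.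
Proof.
move=> ht; have -> : 'D_1 (itv_bump c e : R -> R) t = 'D_1 (cst (0 : R)) t.
  apply: near_eq_derive.
  have : nbhs t [set s : R | e < `|s - c|].
    apply: open_nbhs_nbhs; split => //.
    apply: (@open_comp _ _ (fun s : R => `|s - c|) [set r : R | e < r]); last exact: open_gt.
    by move=> y _; apply: cvg_norm; apply: cvgB => //; exact: cvg_cst.
  by apply: filterS => y /= hy; apply: itv_bump_eq0; exact: ltW.
exact: derive_cst.
Qed.

Lemma within_itv_continuous (a b : R) (g : R -> R) :
  (forall t, a <= t <= b -> {for t, continuous g}) -> {within `[a, b], continuous g}.
Proof. by move=> cg; apply: continuous_in_subspaceT => t; rewrite inE/= in_itv/= => /cg. Qed.

Lemma integrable_itv_continuous (a b : R) (g : R -> R) :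
  (forall t, a <= t <= b -> {for t, continuous g}) -> leb.-integrable `[a, b] (EFin \o g).
Proof.
by move=> cg; apply: continuous_compact_integrable; [exact: segment_compact|exact: within_itv_continuous].
Qed.

(** If [Z t0] were not [0], then [Z t * Z t0] would be positive on the support of
a narrow bump. *)
Lemma fundamental_lemma (t0 tau0 : R) (Z : R -> R) : 0 < tau0 ->
  {for t0, continuous Z} -> (forall t, `|t - t0| < tau0 -> {for t, continuous Z}) ->
  (forall tau, 0 < tau < tau0 ->
    \int[leb]_(t in `[t0 - tau, t0 + tau]) (itv_bump t0 tau t * Z t) = 0) ->
  Z t0 = 0.
Proof.
move=> tau00 cZ0 cZ HZ; apply: contrapT => /eqP Z0.
have ZZ0 : 0 < Z t0 * Z t0 by rewrite -expr2 exprn_even_gt0.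
have : \forall t \near t0, 0 < Z t * Z t0.
  have : Z t * Z t0 @[t --> t0] --> Z t0 * Z t0 by apply: cvgM => //; exact: cvg_cst.
  by move/cvgr_gt; exact.
move=> /nbhs_ballP[e /= e0 eZ].
pose tau := Num.min e tau0 / 2.
have m0 : 0 < Num.min e tau0 by rewrite lt_min e0.
have tau_0 : 0 < tau by rewrite divr_gt0.
have taum : tau < Num.min e tau0 by rewrite /tau; lra.
have [taue tautau0] : tau < e /\ tau < tau0 by move: taum; rewrite lt_min => /andP.
have Zpos t : t0 - tau <= t <= t0 + tau -> 0 < Z t * Z t0.
  move=> /andP[h1 h2]; apply: eZ; rewrite /ball/= distrC (le_lt_trans _ taue)// ler_norml; lra.
have tt t : t0 - tau <= t <= t0 + tau -> `|t - t0| < tau0.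
  by move=> /andP[h1 h2]; rewrite (le_lt_trans _ tautau0)// ler_norml; lra.
pose g t := itv_bump t0 tau t * Z t.
have cg t : t0 - tau <= t <= t0 + tau -> {for t, continuous g}.
  move=> ht; apply: (@continuousM R R (itv_bump t0 tau) Z t); first exact: continuous_itv_bump.
  exact/cZ/tt.
have ig := integrable_itv_continuous cg.
have ig' : leb.-integrable `[t0 - tau, t0 + tau] (EFin \o (fun t => Z t0 * g t)).
  by apply: integrable_itv_continuous => t ht; apply: continuousM; [exact: cvg_cst|exact: cg].
have : \int[leb]_(t in `[t0 - tau, t0 + tau]) (Z t0 * g t) = 0.
  by rewrite RintegralZl// HZ ?mulr0// tau_0.
rewrite /Rintegral => /eqP; rewrite fine_eq0; last exact: integrable_fin_num.
move=> /eqP H.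
have [_ H2] := ae_eq_integral_abs leb (measurable_itv `[t0 - tau, t0 + tau]) (measurable_int _ ig').
have [H1 _] := ae_eq_integral_abs leb (measurable_itv `[t0 - tau, t0 + tau]) (measurable_int _ ig').
have {H2}[|N [mN N0 hN]] := H1 _.
  rewrite -H; apply: eq_integral => t; rewrite inE/= in_itv/= => ht.
  by rewrite /= ger0_norm// /g mulrCA mulr_ge0 ?itv_bump_ge0// mulrC ltW// Zpos.
pose I : set R := `]t0 - tau, t0 + tau[%classic.
have : (leb I <= leb N)%E.
  apply: le_measure; rewrite ?inE//; first exact: measurable_itv.
  move=> t; rewrite /I /= in_itv/= => /andP[h1 h2]; apply: hN => /= h.
  have : t \in `[t0 - tau, t0 + tau] by rewrite in_itv/= !ltW.
  move=> /h [] /eqP; rewrite /g mulrCA (mulrC (Z t0)) gt_eqF// mulr_gt0 ?Zpos ?ltW ?h1//.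
  by apply: itv_bump_gt0; rewrite ltr_norml; lra.
rewrite N0 /I lebesgue_measure_itv/= lte_fin ifT; last by lra.
by rewrite -EFinD lee_fin; lra.
Qed.

Lemma Rintegral_support (a b : R) (T g : R -> R) : 0 < a -> b < 1 ->
  (forall t, a <= t <= b -> T t = g t) ->
  (forall t, 0 < t < 1 -> ~~ (a <= t <= b) -> T t = 0) ->
  \int[leb]_(t in `]0, 1[) T t = \int[leb]_(t in `[a, b]) g t.
Proof.
move=> a0 b1 Tg T0; rewrite Rintegral_mkcond [RHS]Rintegral_mkcond.
congr (Rintegral leb _ _); apply/funext => t; rewrite !patchE.
have [tab|ntab] := boolP (a <= t <= b).
  rewrite [X in _ = if X then _ else _]mem_set ?mem_set; rewrite ?Tg//=; rewrite in_itv/=//.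
  by move: tab => /andP[h1 h2]; lra.
rewrite [X in _ = if X then _ else _]memNset; last by rewrite /= in_itv/=; exact/negP.
case: ifPn => //; rewrite inE/= in_itv/= => t01; exact: T0.
Qed.

(** [T1] and [T2] stand for the integrands of the two terms of the momentum
equation. The part with the derivative of the bump is integrated by parts,
and the bump then concentrates at [t0]. *)
Lemma time_localisation (t0 tau0 : R) (g1 g2 g3 dg3 : R -> R) :
  0 < tau0 -> 0 <= t0 - tau0 -> t0 + tau0 <= 1 ->
  (forall t, `|t - t0| < tau0 -> {for t, continuous g1}) ->
  (forall t, `|t - t0| < tau0 -> {for t, continuous g2}) ->
  (forall t, `|t - t0| < tau0 -> {for t, continuous dg3}) ->
  (forall t, `|t - t0| < tau0 -> is_derive t 1 g3 (dg3 t)) ->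
  (forall tau, 0 < tau < tau0 -> exists T1 T2 : R -> R,
    [/\ forall t, 0 < t < 1 -> `|t - t0| < tau0 ->
          T1 t = itv_bump t0 tau t * g1 t /\
          T2 t = itv_bump t0 tau t * g2 t + 'D_1 (itv_bump t0 tau : R -> R) t * g3 t,
        forall t, 0 < t < 1 -> tau0 <= `|t - t0| -> T1 t = 0 /\ T2 t = 0 &
        \int[leb]_(t in `]0, 1[) T1 t + \int[leb]_(t in `]0, 1[) T2 t = 0]) ->
  g1 t0 + g2 t0 - dg3 t0 = 0.
Proof.
move=> tau00 ta tb c1 c2 cd3 d3 HT.
pose Z t := g1 t + g2 t - dg3 t.
have cZ t : `|t - t0| < tau0 -> {for t, continuous Z}.
  move=> ht; apply: (@continuousB _ _ _ (g1 \+ g2) dg3); last exact: cd3.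
  by apply: (@continuousD _ _ _ g1 g2); [exact: c1|exact: c2].
have c3 t : `|t - t0| < tau0 -> {for t, continuous g3}.
  move=> ht; apply: differentiable_continuous; apply/derivable1_diffP.
  by have [] := d3 t ht.
apply: (@fundamental_lemma t0 tau0 Z tau00) => //.
  by apply: cZ; rewrite subrr normr0.
move=> tau tau01; have /andP[tau_0 tautau0] := tau01.
have [T1 [T2 [HT1 HT2 HI]]] := HT _ tau01.
set a := t0 - tau; set b := t0 + tau.
pose th : R -> R := itv_bump t0 tau.
pose dth : R -> R := 'D_1 (itv_bump t0 tau : R -> R).
have dthE (t : R) : is_derive t 1 th (dth t).
  apply/derivableP; apply/derivable1_diffP.
  exact/smooth_differentiable/smooth_itv_bump_id.
have cdth : continuous dth by exact/smooth_continuous/smooth_derive/smooth_itv_bump_id.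
have cth : continuous th by exact: continuous_itv_bump.
have th0 (t : R) : tau <= `|t - t0| -> th t = 0 by exact: itv_bump_eq0.
have tt t : a <= t <= b -> `|t - t0| < tau0.
  by move=> /andP[h1 h2]; rewrite (le_lt_trans _ tautau0)// ler_norml; move: h1 h2; rewrite /a /b; lra.
have dth0 (t : R) : tau < `|t - t0| -> dth t = 0 by exact: derive_itv_bump_eq0.
have out (t : R) : ~~ (a <= t <= b) -> tau < `|t - t0|.
  by rewrite lter_normr negb_and -!ltNge /a /b => /orP[h|h]; apply/orP; [right|left]; lra.
have a0 : 0 < a by rewrite /a; lra.
have b1 : b < 1 by rewrite /b; lra.
have ab : a < b by rewrite /a /b; lra.
have zo t : 0 < t < 1 -> ~~ (a <= t <= b) -> T1 t = 0 /\ T2 t = 0.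
  move=> t01 /out ht; case: (ltP `|t - t0| tau0) => h; last exact: HT2.
  have [-> ->] := HT1 _ t01 h.
  by rewrite -/(th t) -/(dth t) th0 ?dth0 ?ltW// !mul0r addr0.
have zi t : a <= t <= b -> 0 < t < 1.
  by move=> /andP[h1 h2]; apply/andP; split; [exact: lt_le_trans h1|exact: le_lt_trans b1].
have E1 : \int[leb]_(t in `]0, 1[) T1 t = \int[leb]_(t in `[a, b]) (th t * g1 t).
  by apply: Rintegral_support => // t ht; [have [] := HT1 _ (zi _ ht) (tt _ ht)|move=> /(zo _ ht)[]].
have E2 : \int[leb]_(t in `]0, 1[) T2 t = \int[leb]_(t in `[a, b]) (th t * g2 t + dth t * g3 t).
  by apply: Rintegral_support => // t ht; [have [] := HT1 _ (zi _ ht) (tt _ ht)|move=> /(zo _ ht)[]].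
(* the total derivative split off from the two integrands *)
pose W t := th t * g3 t.
pose dW t := th t * dg3 t + g3 t * dth t.
have dWE t : `|t - t0| < tau0 -> is_derive t 1 W (dW t).
  by move=> ht; apply: (is_derive_eq (is_deriveM (dthE t) (d3 t ht))).
have cdW t : a <= t <= b -> {for t, continuous dW}.
  move=> /tt ht; apply: (@continuousD _ _ _ (fun t => th t * dg3 t) (fun t => g3 t * dth t)).
    by apply: (@continuousM _ _ th dg3); [exact: cth|exact: cd3].
  by apply: (@continuousM _ _ g3 dth); [exact: c3|exact: cdth].
have cW t : a <= t <= b -> {for t, continuous W}.
  by move=> /tt ht; apply: (@continuousM _ _ th g3); [exact: cth|exact: c3].
have IW : \int[leb]_(t in `[a, b]) dW t = 0.
  rewrite /Rintegral (@continuous_FTC2 _ dW W)//.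
  - have tha : th a = 0 by apply: th0; rewrite /a ler_normr; apply/orP; right; lra.
    have thb : th b = 0 by apply: th0; rewrite /b ler_normr; apply/orP; left; lra.
    by rewrite /W tha thb !mul0r subee.
  - exact: within_itv_continuous.
  - split.
    + move=> t; rewrite in_itv/= => /andP[h1 h2].
      by have [] := dWE t (tt t _); rewrite ?ltW//; apply/andP; split; exact: ltW.
    + by apply: cvg_at_right_filter; apply: cW; rewrite lexx ltW.
    + by apply: cvg_at_left_filter; apply: cW; rewrite lexx ltW.
  - move=> t; rewrite in_itv/= => /andP[h1 h2]; rewrite derive1E.
    by apply: derive_val; apply: dWE; apply: tt; rewrite !ltW.
have cthg g : (forall t, `|t - t0| < tau0 -> {for t, continuous g}) ->
    forall t, a <= t <= b -> {for t, continuous (fun t => th t * g t)}.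
  by move=> cg t ht; apply: (@continuousM _ _ th g); [exact: cth|exact/cg/tt].
have -> : \int[leb]_(t in `[a, b]) (itv_bump t0 tau t * Z t) =
    \int[leb]_(t in `[a, b]) (th t * g1 t + (th t * g2 t + dth t * g3 t)) -
    \int[leb]_(t in `[a, b]) dW t.
  rewrite -RintegralB//.
  - by apply: eq_Rintegral => t _; rewrite /Z /dW -/(th t); ring.
  - apply: integrable_itv_continuous => t ht.
    apply: (@continuousD _ _ _ (fun t => th t * g1 t) (fun t => th t * g2 t + dth t * g3 t)).
      exact: cthg.
    apply: (@continuousD _ _ _ (fun t => th t * g2 t) (fun t => dth t * g3 t)); first exact: cthg.
    by apply: (@continuousM _ _ dth g3); [exact: cdth|exact/c3/tt].
  - exact: integrable_itv_continuous.
rewrite IW subr0 RintegralD//.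
- by rewrite -E1 -E2.
- by apply: integrable_itv_continuous; exact: cthg.
- apply: integrable_itv_continuous => t ht.
  apply: (@continuousD _ _ _ (fun t => th t * g2 t) (fun t => dth t * g3 t)); first exact: cthg.
  by apply: (@continuousM _ _ dth g3); [exact: cdth|exact/c3/tt].
Qed.

End time_localisation.

Lemma is_derive_invX (R : realType) n (s : R) : s != 0 ->
  is_derive s 1 (fun s => (s ^+ n)^-1) (- (n%:R / s / s ^+ n)).
Proof.
move=> s0; have sn0 : s ^+ n != 0 by rewrite expf_neq0.
have DX : is_derive s 1 (fun s : R => s ^+ n) (n%:R * s ^+ n.-1).
  by apply: DeriveDef; [exact: exprn_derivable|rewrite exp_derive /GRing.scale/= mulr1].
apply: (is_derive_eq (@is_deriveV R (fun s : R => s ^+ n) s _ 1 sn0 DX)).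
have -> : n%:R * s ^+ n.-1 = n%:R * s ^+ n / s.
  case: (n) => [|m]; first by rewrite !mul0r.
  by rewrite /= exprSr mulrA mulfK.
by rewrite /GRing.scale/=; field; rewrite sn0 s0.
Qed.

Lemma is_derive_power_moment (R : realType) n (g : R -> R) (dg s : R) :
  s != 0 -> is_derive s 1 g dg ->
  is_derive s 1 (fun s => s * (s ^+ n)^-1 * g s)
    ((1 - n%:R) * (s ^+ n)^-1 * g s + s * (s ^+ n)^-1 * dg).
Proof.
move=> s0 Dg; have sn0 : s ^+ n != 0 by rewrite expf_neq0.
have H := is_deriveM (is_deriveM (is_derive_id s 1) (is_derive_invX n s0)) Dg.
apply: (is_derive_eq H); rewrite /GRing.scale/= -[(id * _) s]/(s * (s ^+ n)^-1).
by field; rewrite sn0 s0.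
Qed.

(** * Lipschitz densities *)

Definition lip_in (R : realType) d (Omega : set 'rV[R]_d) (L : R) (f : 'rV[R]_d -> R) :=
  0 <= L /\ forall x y, Omega x -> Omega y -> `|f x - f y| <= L * `|x - y|.

Lemma lipschitz_lip_in (R : realType) d (Omega : set 'rV[R]_d) (f : 'rV[R]_d -> R) :
  [lipschitz f x | x in Omega] -> exists L, lip_in Omega L f.
Proof.
move=> [M [Mr HM]]; exists (`|M| + 1); split; first by rewrite addr_ge0.
move=> x y Ox Oy.
have := HM (`|M| + 1).
rewrite (le_lt_trans (ler_norm M)) ?ltrDl// => /(_ isT).
by rewrite /dominated_by /= /globally /= => /(_ (x, y)); apply.
Qed.

Section lip_density.
Context {R : realType} {d : nat}.
Variables (Omega : set 'rV[R]_d) (L : R) (f : 'rV[R]_d -> R).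
Hypotheses (cO : closed Omega) (lf : lip_in Omega L f).

Lemma lip_in_close (x : 'rV[R]_d) (e : R) : Omega x -> 0 < e ->
  exists2 dlt, 0 < dlt & forall y, Omega y -> ball x dlt y -> `|f x - f y| < e.
Proof.
move=> Ox e0; have [L0 HL] := lf.
have L1 : 0 < L + 1 by rewrite ltr_wpDl.
exists (e / (L + 1)); first by rewrite divr_gt0.
move=> y Oy; rewrite -ball_normE /= => xy; apply: le_lt_trans (HL _ _ Ox Oy) _.
move: xy; rewrite ltr_pdivlMr// mulrDr mulr1 mulrC; apply: le_lt_trans.
by rewrite lerDl.
Qed.

(** The preimage in [Omega] of an open set is the trace of an open set. *)
Lemma measurable_lip_in : measurable_fun setT (f \_ Omega).
Proof.
have mO := measurable_rV_closed cO.
apply/(measurable_restrictT f mO).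
apply: (measurability _ (RGenOpens.measurableE R)) => _ [_ [a [b ->]] <-].
pose V := [set z | exists2 dlt, 0 < dlt & forall y, ball z dlt y -> Omega y -> `]a, b[%classic (f y)].
have -> : Omega `&` f @^-1` `]a, b[ = Omega `&` V.
  apply/seteqP; split=> x [Ox]; last first.
    by move=> [dlt dlt0 h]; split=> //; apply: h => //; exact: ballxx.
  have /= : open `]a, b[%classic by exact: interval_open.
  move=> oI Ix; split => //.
  have /nbhs_ballP[e /= e0 eI] : nbhs (f x) `]a, b[%classic by apply: open_nbhs_nbhs.
  have [dlt dlt0 h] := lip_in_close Ox e0.
  by exists dlt => // y xy Oy; apply: eI; exact: h.
apply: measurableI => //; apply: measurable_rV_open.
rewrite openE => z [dlt dlt0 h]; apply/nbhs_ballP; exists (dlt / 2); first by rewrite /= divr_gt0.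
move=> w zw; exists (dlt / 2); first by rewrite divr_gt0.
by move=> y wy; apply: h; rewrite (splitr dlt); exact: ball_triangle zw wy.
Qed.

Lemma locally_bounded_lip_in : Omega 0 -> locally_bounded (f \_ Omega).
Proof.
move=> O0 K; have [L0 HL] := lf.
exists (`|f 0| + L * `|K|); first by rewrite addr_ge0// mulr_ge0.
move=> x xK; rewrite patchE; case: ifPn => [|_]; last by rewrite normr0 addr_ge0// mulr_ge0.
rewrite inE => Ox.
rewrite -[X in `|X|](subrKC (f 0)); apply: le_trans (ler_normD _ _) _.
rewrite lerD2l; apply: le_trans (HL _ _ Ox O0) _; rewrite subr0.
by rewrite ler_wpM2l// (le_trans xK)// ler_norm.
Qed.

Lemma continuous_ray (x : 'rV[R]_d) : convex_rV Omega -> Omega 0 -> Omega x ->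
  {within `[0, 1], continuous (fun l : R => f (l *: x))}.
Proof.
move=> cvO O0 Ox; have [L0 HL] := lf.
have ray_in (l : R) : 0 <= l <= 1 -> Omega (l *: x).
  by move=> /(cvO _ _ l Ox O0); rewrite scaler0 addr0.
apply/subspace_continuousP => l /=; rewrite in_itv/= => l01.
apply/cvgrPdist_le => eps eps0.
have k0 : 0 < L * `|x| + 1 by rewrite ltr_wpDl// mulr_ge0.
rewrite near_withinE; near=> z.
rewrite /= in_itv/= => z01.
apply: le_trans (HL _ _ (ray_in _ l01) (ray_in _ z01)) _.
rewrite -scalerBl normrZ mulrCA.
have : `|l - z| <= eps / (L * `|x| + 1).
  by near: z; apply: cvgr_dist_le => //; rewrite divr_gt0.
rewrite ler_pdivlMr//; apply: le_trans.
by rewrite ler_wpM2l// lerDl.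
Unshelve. all: by end_near. Qed.

(** If [f x < 0], then [f] is bounded above by a negative constant on a ball
contained in [Omega], and the integral over that ball is negative. *)
Lemma density_ge0 : convex_rV Omega -> @lebesgue_rV R d Omega != 0%E ->
  (forall A, measurable A -> 0 <= \int[@lebesgue_rV R d]_(x in A `&` Omega) (f x)%:E)%E ->
  forall x, Omega x -> 0 <= f x.
Proof.
move=> cvO O0 Hpos x Ox; rewrite leNgt; apply/negP => fx0.
pose k := - f x / 2.
have k0 : 0 < k by rewrite /k; lra.
have mO := measurable_rV_closed cO.
have [dlt dlt0 h] := lip_in_close Ox k0.
have [w [e [e0 Ow]]] := convex_pos_ball mO cvO O0.
have [c [e' [e'0 hc]]] := convex_ball_dense cvO e0 Ow Ox dlt0.
have mB : measurable (ball c e') by apply: measurable_rV_open; exact: ball_open.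
have BO : ball c e' `&` Omega = ball c e'.
  by apply/seteqP; split=> [y []//|y By]; split => //; have [] := hc _ By.
have := Hpos _ mB; rewrite BO; apply/negP; rewrite -ltNge.
have fB y : ball c e' y -> f y <= - k /\ `|f y| <= 3 * k.
  move=> /hc[Oy /h -/(_ Oy)]; rewrite ltr_norml ler_norml /k => /andP[h1 h2].
  by split; [lra|apply/andP; split; lra].
have Bfin : (lebesgue_rV (ball c e') < +oo)%E by rewrite lebesgue_rV_ball// ltry.
have fr y : ball c e' y -> (f \_ Omega) y = f y.
  by move=> /hc[Oy _]; rewrite patchE mem_set.
apply: (@le_lt_trans _ _ (\int[@lebesgue_rV R d]_(x in ball c e') (- k)%:E)%E).
  rewrite (@eq_integral _ _ _ _ _ (EFin \o (f \_ Omega))); last first.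
    by move=> y; rewrite inE => By; rewrite /comp fr.
  apply: le_integral => //.
  - apply: measurable_bounded_integrable => //.
      exact: measurable_funTS measurable_lip_in.
    exists (3 * k); split; first exact: num_real.
    move=> M kM y By; have := (fB _ By).2; rewrite -(fr _ By) => h3.
    exact: (le_trans h3 (ltW kM)).
  - apply: (@measurable_bounded_integrable _ _ _ _ (cst (- k))) => //.
    exists k; split; first exact: num_real.
    by move=> M kM y By; rewrite /= normrN gtr0_norm// ltW.
  - by move=> y; rewrite inE => By; rewrite /comp lee_fin fr// (fB _ By).1.
rewrite integral_cst//.
suff : ((- k)%:E * lebesgue_rV (ball c e') < 0)%E by [].
rewrite lebesgue_rV_ball// -EFinM lte_fin mulNr oppr_lt0.
by rewrite mulr_gt0// exprn_gt0// pmulrn_lgt0.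
Qed.

End lip_density.

Section Rintegral_scale.
Context {R : realType} d (T : measurableType d) (mu : {measure set T -> \bar R}).

Lemma integral_gt0Zl (c : R) (f : T -> \bar R) : 0 < c -> measurable_fun setT f ->
  (\int[mu]_x (c%:E * f x) = c%:E * \int[mu]_x f x)%E.
Proof.
move=> c0 mf; rewrite [LHS]integralE [in RHS]integralE.
rewrite (ge0_funeposM _ (ltW c0)) (ge0_funenegM _ (ltW c0)) gt0_muleB//.
rewrite !ge0_integralZl//; try exact: ltW.
- exact: measurable_funeneg.
- exact: measurable_funepos.
Qed.

Lemma Rintegral_gt0Zl (c : R) (f : T -> R) : 0 < c -> measurable_fun setT f ->
  \int[mu]_x (c * f x) = c * \int[mu]_x f x.
Proof.
move=> c0 mf; rewrite /Rintegral; under eq_integral do rewrite EFinM.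
rewrite integral_gt0Zl//; last exact/measurable_EFinP.
by case: integral => [r| |] //=; rewrite ?gt0_muley ?gt0_muleNy ?lte_fin//= mulr0.
Qed.

End Rintegral_scale.

(** * Scaling of the densities of a self-similar curve *)

Section profile.
Context {R : realType} {d : nat}.
Local Notation Leb := (@lebesgue_rV R d).
Variables (Omega : set 'rV[R]_d) (u : R -> 'rV[R]_d -> R) (r : R -> R)
  (mu : R -> probability 'rV[R]_d R) (mubar : {measure set 'rV[R]_d -> \bar R}).
Hypotheses (cO : closed Omega) (cvO : convex_rV Omega) (O0 : Omega 0).
Hypothesis lipu : forall t, 0 <= t <= 1 -> exists L, lip_in Omega L (u t).
Hypothesis r_gt0 : forall t, 0 <= t <= 1 -> 0 < r t.
Hypothesis muE : forall t, 0 <= t <= 1 -> forall A, measurable A ->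
  mu t A = (\int[Leb]_(x in A `&` Omega) (u t x)%:E)%E /\
  mu t A = pushforward mubar (fun x => r t *: x) A.

(** Extended by [0], the densities are dilations of each other almost everywhere
in the whole space, however the dilated domains are placed. *)
Definition dens t := u t \_ Omega.

Let mO : measurable Omega. Proof. exact: measurable_rV_closed. Qed.

Lemma measurable_dens t : 0 <= t <= 1 -> measurable_fun setT (dens t).
Proof. by move=> /lipu[L lL]; exact: measurable_lip_in cO lL. Qed.

Lemma mu_dens t A : 0 <= t <= 1 -> measurable A ->
  mu t A = (\int[Leb]_(x in A) (dens t x)%:E)%E.
Proof.
move=> t01 mA; have [-> _] := muE t01 mA; rewrite integral_mkcondr.
apply: eq_integral => x _; rewrite /dens !patchE; by case: ifPn.
Qed.

Lemma Omega_not_null : Leb Omega != 0%E.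
Proof.
have t01 : 0 <= (0 : R) <= 1 by rewrite lexx ler01.
apply/eqP => O_0; have := @probability_setT _ _ _ (mu 0).
have [-> _] := muE t01 measurableT; rewrite setTI.
rewrite null_set_integral//; last first.
  have [L lL] := lipu t01.
  by apply/measurable_EFinP/(measurable_restrictT _ mO); exact: measurable_lip_in cO lL.
by move/eqP; rewrite eq_sym onee_eq0.
Qed.

Lemma dens_in_ge0 t : 0 <= t <= 1 -> forall x, Omega x -> 0 <= u t x.
Proof.
move=> t01; have [L lL] := lipu t01.
apply: (density_ge0 cO lL cvO Omega_not_null) => A mA.
by have [<- _] := muE t01 mA.
Qed.

Lemma dens_ge0 t x : 0 <= t <= 1 -> 0 <= dens t x.
Proof.
by move=> t01; rewrite /dens patchE; case: ifPn => // /set_mem; exact: dens_in_ge0.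
Qed.

Lemma integral_dens t : 0 <= t <= 1 -> (\int[Leb]_x (dens t x)%:E = 1)%E.
Proof. by move=> t01; rewrite -mu_dens//; exact: probability_setT. Qed.

Lemma integrable_dens t : 0 <= t <= 1 -> Leb.-integrable setT (EFin \o dens t).
Proof.
move=> t01; apply/integrableP; split; first by apply/measurable_EFinP; exact: measurable_dens.
under eq_integral do rewrite /= ger0_norm ?dens_ge0//.
by rewrite integral_dens// ltry.
Qed.

(** Both measures are dilations of [mubar], so [mu t A] is the [mu s]-measure of
the rescaled set; changing variables identifies the densities. *)
Lemma dens_scaling s t : 0 <= s <= 1 -> 0 <= t <= 1 ->
  {ae Leb, forall x, dens t x = ((r t / r s) ^+ d)^-1 * dens s ((r t / r s)^-1 *: x)}.
Proof.
move=> s01 t01; set rho := r t / r s.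
have rho0 : 0 < rho by rewrite divr_gt0// r_gt0.
have ri0 : 0 < rho^-1 by rewrite invr_gt0.
have mds : measurable_fun setT (fun x : 'rV[R]_d => dens s (rho^-1 *: x)).
  apply: (@measurableT_comp _ _ _ _ _ _ (dens s)); first exact: measurable_dens.
  exact: measurable_scale.
have mg : measurable_fun setT (fun x : 'rV[R]_d => (rho ^+ d)^-1 * dens s (rho^-1 *: x)).
  exact: measurable_funM.
have H : ae_eq Leb setT (EFin \o dens t)
    (EFin \o (fun x => (rho ^+ d)^-1 * dens s (rho^-1 *: x))).
  apply: integral_ae_eq => //; [exact: integrable_dens|exact/measurable_EFinP|].
  move=> A _ mA; rewrite -mu_dens//.
  pose B := (fun x : 'rV[R]_d => rho *: x) @^-1` A.
  have mB : measurable B by rewrite -[B]setTI; exact: measurable_scale.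
  have -> : mu t A = mu s B.
    have [_ ->] := muE t01 mA; have [_ ->] := muE s01 mB.
    rewrite /pushforward /B; congr (mubar _); apply/seteqP; split=> x /=;
      by rewrite scalerA /rho divfK// gt_eqF// r_gt0.
  rewrite mu_dens// [LHS]integral_mkcond [RHS]integral_mkcond [LHS](integral_dilation ri0); last first.
    by apply/(measurable_restrictT (fun x => (dens s x)%:E) mB); apply: measurable_funTS; apply/measurable_EFinP; exact: measurable_dens.
  rewrite -integral_gt0Zl//; last 2 first.
  - by rewrite exprn_gt0.
  - apply: (@measurableT_comp _ _ _ _ _ _ ((fun x => (dens s x)%:E) \_ B)); last exact: measurable_scale.
    by apply/(measurable_restrictT (fun x => (dens s x)%:E) mB); apply: measurable_funTS; apply/measurable_EFinP; exact: measurable_dens.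
  apply: eq_integral => x _; rewrite !patchE.
  have -> : (rho^-1 *: x \in B) = (x \in A).
    by apply/idP/idP; rewrite !inE /B /= scalerA divff ?gt_eqF// scale1r.
  by case: ifPn => _; rewrite ?mule0// /comp EFinM exprVn.
by apply: filterS H => x H; have := H I; rewrite /comp => -[].
Qed.

(** Of the [k.+1] factors [rho ^- d] carried by the density, one is absorbed by
the change of variables. *)
Lemma transport s t k (H : 'rV[R]_d -> R) : 0 <= s <= 1 -> 0 <= t <= 1 ->
  measurable_fun setT H ->
  \int[Leb]_(x in Omega) (H x * u t x ^+ k.+1) =
  ((r t / r s) ^+ (d * k))^-1 *
    \int[Leb]_y (H ((r t / r s) *: y) * dens s y ^+ k.+1).
Proof.
move=> s01 t01 mH; set rho := r t / r s.
have rho0 : 0 < rho by rewrite divr_gt0// r_gt0.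
have mds (c : R) : measurable_fun setT (fun x : 'rV[R]_d => dens s (c *: x)).
  apply: (@measurableT_comp _ _ _ _ _ _ (dens s)); first exact: measurable_dens.
  exact: measurable_scale.
have mHs (c : R) : measurable_fun setT (fun x : 'rV[R]_d => H (c *: x)).
  by apply: (@measurableT_comp _ _ _ _ _ _ H) => //; exact: measurable_scale.
rewrite Rintegral_mkcond.
have -> : (fun x => H x * u t x ^+ k.+1) \_ Omega = fun x => H x * dens t x ^+ k.+1.
  apply/funext => x; rewrite /dens !patchE; case: ifPn => //.
  by rewrite expr0n mulr0.
pose g x := H x * ((rho ^+ d)^-1 * dens s (rho^-1 *: x)) ^+ k.+1.
have mg : measurable_fun setT g.
  by apply: measurable_funM => //; apply: measurable_funX; apply: measurable_funM.
have -> : \int[Leb]_x (H x * dens t x ^+ k.+1) = \int[Leb]_x g x.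
  rewrite /Rintegral; congr fine; apply: ae_eq_integral => //.
  - apply/measurable_EFinP; apply: measurable_funM => //.
    by apply: measurable_funX; exact: measurable_dens.
  - exact/measurable_EFinP.
  - by apply: filterS (dens_scaling s01 t01) => x -> _.
rewrite (Rintegral_dilation rho0)//.
have -> : (fun x : 'rV[R]_d => g (rho *: x)) =
    fun x => ((rho ^+ d)^-1 ^+ k.+1) * (H (rho *: x) * dens s x ^+ k.+1).
  apply/funext => x; rewrite /g scalerA mulVf ?gt_eqF// scale1r exprMn; ring.
rewrite Rintegral_gt0Zl; last 2 first.
- by rewrite exprn_gt0// invr_gt0 exprn_gt0.
- apply: measurable_funM => //; apply: measurable_funX; exact: measurable_dens.
rewrite mulrA; congr (_ * _).
by rewrite exprM exprS exprVn mulrA divff ?mul1r// gt_eqF// exprn_gt0.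
Qed.

End profile.

(** * Radial test fields *)

Section test_field.
Context {R : realType} {d : nat}.
Implicit Types (th : R -> R) (phi : 'rV[R]_d -> R).

(** The velocity is parallel to [x]; test fields parallel to [x] suffice to
determine the density along rays. *)
Definition radial_field th phi (p : R * 'rV[R]_d) : 'rV[R]_d := (th p.1 * phi p.2) *: p.2.

Lemma smooth_radial_field th phi : smooth th -> smooth phi -> smooth (radial_field th phi).
Proof.
move=> sth sphi; apply: smooth_mx => j.
have -> : (fun p => radial_field th phi p 0 j) =
    fun p : R * 'rV[R]_d => (th p.1 * phi p.2) * p.2 0 j.
  by apply/funext => p; rewrite mxE.
apply: smoothM; first apply: smoothM.
- exact: smooth_comp_affine (affine_fst _ _) sth.
- exact: smooth_comp_affine (affine_snd _ _) sphi.
- by apply: (smooth_comp_affine (affine_snd R 'rV[R]_d) (affine_smooth (affine_coord j))).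
Qed.

Lemma momentum_test_radial_field (Omega : set 'rV[R]_d) (t0 tau : R) phi
    (C : set 'rV[R]_d) :
  smooth phi -> 0 < t0 - tau -> t0 + tau < 1 -> compact C -> C `<=` Omega° ->
  (forall x, ~ C x -> phi x = 0) ->
  momentum_test Omega (radial_field (itv_bump t0 tau) phi).
Proof.
move=> sphi t0a t0b cC CO phi0; split.
  by apply: smooth_radial_field => //; exact: smooth_itv_bump_id.
exists (`[t0 - tau, t0 + tau]%classic `*` C).
  by apply: compact_setX => //; exact: segment_compact.
split.
  move=> [t x] [/= ht Cx]; split; last exact: CO.
  by move: ht => /=; rewrite !in_itv/= => /andP[h1 h2]; rewrite (lt_le_trans t0a)// (le_lt_trans h2).
move=> [t x] /not_andP[] /= h; rewrite /radial_field /=; last by rewrite phi0// mulr0 scale0r.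
rewrite itv_bump_eq0 ?mul0r ?scale0r//.
rewrite leNgt; apply/negP => h'; apply: h; rewrite in_itv/=.
by move: h'; rewrite ltr_norml => /andP[h1 h2]; apply/andP; split; lra.
Qed.

Lemma radial_field_differentiable k phi x : smooth phi ->
  differentiable (fun y : 'rV[R]_d => (k * phi y) *: y) x.
Proof.
move=> sphi; apply: smooth_differentiable; apply: smooth_mx => j.
have -> : (fun y : 'rV[R]_d => ((k * phi y) *: y) 0 j) = fun y => k * phi y * y 0 j.
  by apply/funext => y; rewrite mxE.
apply: smoothM; last exact/affine_smooth/affine_coord.
by apply: smoothM => //; exact: smooth_cst.
Qed.

Lemma derive_coord (x v : 'rV[R]_d) i : 'D_v (fun y : 'rV[R]_d => y 0 i) x = v 0 i.
Proof.
rewrite deriveE; last exact: differentiable_coord.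
have lc : linear (fun x : 'rV[R]_d => x 0 i) by move=> a y z; rewrite !mxE.
pose L : {linear 'rV[R]_d -> R} := HB.pack (fun x : 'rV[R]_d => x 0 i) (GRing.isLinear.Build _ _ _ _ _ lc).
rewrite (_ : (fun x : 'rV[R]_d => x 0 i) = L)// diff_lin//.
exact: coord_continuous.
Qed.

Lemma radial_field_derive k phi x v : smooth phi ->
  'D_v (fun y : 'rV[R]_d => (k * phi y) *: y) x = k *: ('D_v phi x *: x + phi x *: v).
Proof.
move=> sphi; rewrite derive_mx; last exact/diff_derivable/radial_field_differentiable.
apply/rowP => j; rewrite !mxE.
have -> : (fun t : 'rV[R]_d => ((k * phi t) *: t) 0 j) =
    (k \*: phi) * (fun t : 'rV[R]_d => t 0 j).
  by apply/funext => y; rewrite mxE.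
have dphi : derivable phi x v by exact/diff_derivable/smooth_differentiable.
rewrite deriveM; last 2 first.
- exact: derivableZ.
- exact/diff_derivable/differentiable_coord.
rewrite derive_coord deriveZ// /GRing.scale/=. rewrite -[k *: phi x]/(k * phi x); ring.
Qed.

Lemma divergence_radial_field k phi x : smooth phi ->
  divergence (fun y : 'rV[R]_d => (k * phi y) *: y) x = k * (d%:R * phi x + radial phi x).
Proof.
move=> sphi; rewrite /divergence /mxtrace /jacobian.
under eq_bigr => i _.
  rewrite mxE -deriveE; last exact: radial_field_differentiable.
  rewrite radial_field_derive// !mxE !eqxx mulr1.
  over.
rewrite -mulr_sumr big_split/= sumr_const card_ord addrC -[phi x *+ d]mulr_natl.
congr (_ * (_ + _)).
rewrite /radial [in RHS]deriveE; last exact: smooth_differentiable.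
transitivity ('d phi x (\sum_(j < d) x 0 j *: delta_mx 0 j)); last by rewrite -row_sum_delta.
rewrite linear_sum; apply: eq_bigr => i _; rewrite linearZ /GRing.scale/= mulrC.
by rewrite deriveE//; exact: smooth_differentiable.
Qed.

Lemma derive1_radial_field th phi t x : smooth th ->
  derive1 (fun s => radial_field th phi (s, x)) t = ('D_1 th t * phi x) *: x.
Proof.
move=> sth; rewrite derive1E /radial_field /=.
have -> : (fun s => (th s * phi x) *: x) = (fun s => th s *: (phi x *: x)).
  by apply/funext => s; rewrite scalerA.
have dth : differentiable th t by exact: smooth_differentiable.
rewrite deriveE; last exact: differentiableZl.
by rewrite diffZl// -deriveE// scalerA.
Qed.

Lemma sqnormZ (c : R) (x : 'rV[R]_d) : sqnorm (c *: x) = c ^+ 2 * sqnorm x.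
Proof.
rewrite /sqnorm /dotr mulr_sumr; apply: eq_bigr => i _; rewrite !mxE; ring.
Qed.

Lemma sqnorm_ge0 (x : 'rV[R]_d) : 0 <= sqnorm x.
Proof. by apply: sumr_ge0 => i _; rewrite -expr2 sqr_ge0. Qed.

Lemma dotrZ (a b : R) (x : 'rV[R]_d) : dotr (a *: x) (b *: x) = a * b * sqnorm x.
Proof.
rewrite /sqnorm /dotr mulr_sumr; apply: eq_bigr => i _; rewrite !mxE; ring.
Qed.

Lemma continuous_sqnorm : continuous (@sqnorm R d).
Proof.
have -> : @sqnorm R d = fun x => \sum_(i <- index_enum 'I_d) (x 0 i * x 0 i) by [].
apply: smooth_continuous; apply: smooth_sum => i.
by apply: smoothM; exact/affine_smooth/affine_coord.
Qed.

Lemma momentum_integrand th phi t x a : smooth th -> smooth phi ->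
  dotr ('d (fun y => radial_field th phi (t, y)) x (a *: x) +
        derive1 (fun s => radial_field th phi (s, x)) t) (a *: x) =
  (a ^+ 2 * th t * (radial phi x + phi x) + a * 'D_1 th t * phi x) * sqnorm x.
Proof.
move=> sth sphi; rewrite derive1_radial_field//.
have -> : 'd (fun y => radial_field th phi (t, y)) x (a *: x) =
    (a * th t * (radial phi x + phi x)) *: x.
  have -> : (fun y => radial_field th phi (t, y)) = (fun y => (th t * phi y) *: y) by [].
  rewrite linearZ/= -deriveE; last exact: radial_field_differentiable.
  by rewrite radial_field_derive// -/(radial phi x) -scalerDl !scalerA.
rewrite -scalerDl dotrZ; ring.
Qed.

End test_field.

(** * The momentum equation at one time *)

Section locally_bounded_lemmas.
Context {R : realType} {d : nat}.

Lemma locally_boundedM (f g : 'rV[R]_d -> R) :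
  locally_bounded f -> locally_bounded g -> locally_bounded (fun x => f x * g x).
Proof.
move=> bf bg K; have [A A0 HA] := bf K; have [B B0 HB] := bg K.
exists (A * B); first exact: mulr_ge0.
by move=> x xK; rewrite normrM ler_pM// ?HA ?HB.
Qed.

Lemma locally_bounded_sqnorm : locally_bounded (@sqnorm R d).
Proof.
move=> K; exists (d%:R * `|K| ^+ 2); first by rewrite mulr_ge0// sqr_ge0.
move=> x xK; rewrite ger0_norm ?sqnorm_ge0//.
apply: (@le_trans _ _ (\sum_(i < d) `|K| ^+ 2)).
  apply: ler_sum => i _; rewrite -expr2 -real_normK ?num_real// lerXn2r ?nnegrE//.
  by rewrite (le_trans (coord_norm_le x i))// (le_trans xK)// ler_norm.
by rewrite sumr_const card_ord mulr_natl.
Qed.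

Lemma locally_boundedX (f : 'rV[R]_d -> R) n :
  locally_bounded f -> locally_bounded (fun x => f x ^+ n).
Proof.
move=> bf K; have [N N0 HN] := bf K; exists (N ^+ n); first exact: exprn_ge0.
by move=> x xK; rewrite normrX lerXn2r ?nnegrE// HN.
Qed.

Lemma measurable_sqnorm : measurable_fun setT (@sqnorm R d).
Proof. by apply: measurable_rV_continuous; exact: continuous_sqnorm. Qed.

End locally_bounded_lemmas.

Section momentum_identity.
Context {R : realType} {d : nat}.
Local Notation Leb := (@lebesgue_rV R d).
Local Notation leb := (@lebesgue_measure R).
Variables (Omega : set 'rV[R]_d) (u : R -> 'rV[R]_d -> R)
  (v : R -> 'rV[R]_d -> 'rV[R]_d) (r r' : R -> R) (t0 : R) (U : 'rV[R]_d -> R).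
Hypotheses (mU : measurable_fun setT U) (bU : locally_bounded U)
  (U_ge0 : forall x, 0 <= U x).
Hypothesis r_gt0 : forall t, 0 < t < 1 -> 0 < r t.
Hypothesis t01 : 0 < t0 < 1.
Let rho t := r t / r t0.
Hypothesis transportU : forall t k (H : 'rV[R]_d -> R), 0 < t < 1 ->
  measurable_fun setT H ->
  \int[Leb]_(x in Omega) (H x * u t x ^+ k.+1) =
  (rho t ^+ (d * k))^-1 * \int[Leb]_y (H (rho t *: y) * U y ^+ k.+1).
Hypothesis dr : forall t : R, 0 < t < 1 -> is_derive t 1 r (r' t).
Hypothesis cr' : forall t : R, 0 < t < 1 -> {for t, continuous r'}.
Hypothesis vE : forall t x, 0 < t < 1 -> Omega x -> v t x = (derive1 r t / r t) *: x.
Hypothesis V_gt0 : 0 < Vfun Omega u v t0.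

Let M := \int[Leb]_y (sqnorm y * U y).
Let F0 := \int[Leb]_y (U y ^+ 2).
Let h1 y := U y ^+ 2.
Let h2 y := sqnorm y * U y.

Let rho_gt0 t : 0 < t < 1 -> 0 < rho t.
Proof. by move=> ht; rewrite divr_gt0// r_gt0. Qed.

Let derive1rE t : 0 < t < 1 -> derive1 r t = r' t.
Proof. by move=> /dr H; rewrite derive1E; exact: derive_val. Qed.

Let msqn : measurable_fun setT (@sqnorm R d).
Proof. exact: measurable_sqnorm. Qed.

Let mh1 : measurable_fun setT h1.
Proof. exact: measurable_funX. Qed.

Let mh2 : measurable_fun setT h2.
Proof. exact: measurable_funM. Qed.

Let bh1 : locally_bounded h1.
Proof. exact: locally_boundedX. Qed.

Let bh2 : locally_bounded h2.
Proof. exact: locally_boundedM locally_bounded_sqnorm bU. Qed.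

Lemma VfunE t : 0 < t < 1 -> Vfun Omega u v t = (r' t / r t0) ^+ 2 * M.
Proof.
move=> ht; rewrite /Vfun.
have -> : \int[Leb]_(x in Omega) (sqnorm (v t x) * u t x) =
   \int[Leb]_(x in Omega) ((r' t / r t) ^+ 2 * sqnorm x * u t x ^+ 1).
  by apply: eq_Rintegral => x; rewrite inE => Ox; rewrite vE// sqnormZ derive1rE.
rewrite transportU//; last by apply: measurable_funM.
rewrite muln0 expr0 invr1 mul1r.
have E : (fun y => (r' t / r t) ^+ 2 * sqnorm (rho t *: y) * U y ^+ 1) =
    (fun y => (r' t / r t0) ^+ 2 * h2 y).
  apply/funext => y; rewrite sqnormZ expr1 /h2 mulrA mulrA; congr (_ * _ * _).
  by rewrite /rho; field; rewrite !gt_eqF// r_gt0.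
rewrite E; have [->|r'0] := eqVneq (r' t) 0.
  by rewrite mul0r expr0n/= mul0r; under eq_Rintegral do rewrite mul0r; rewrite Rintegral_cst//= mul0r.
by rewrite Rintegral_gt0Zl// exprn_even_gt0//= mulf_neq0// invr_neq0// gt_eqF// r_gt0.
Qed.

Lemma FfunE t : 0 < t < 1 -> Ffun Omega u t = (rho t ^+ d)^-1 * F0.
Proof.
move=> ht; rewrite /Ffun.
have -> : \int[Leb]_(x in Omega) (u t x ^+ 2) = \int[Leb]_(x in Omega) (cst 1 x * u t x ^+ 2).
  by apply: eq_Rintegral => x _; rewrite mul1r.
rewrite transportU// muln1; congr (_ * _).
by apply: eq_Rintegral => x _; rewrite mul1r.
Qed.

Lemma second_moment_ge0 : 0 <= M.
Proof. by apply: Rintegral_ge0 => y _; rewrite mulr_ge0// sqnorm_ge0. Qed.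

Lemma speed_neq0 : r' t0 != 0.
Proof.
by apply/eqP => h; move: V_gt0; rewrite VfunE// h mul0r expr0n mul0r ltxx.
Qed.

Lemma second_moment_gt0 : 0 < M.
Proof.
rewrite lt_neqAle second_moment_ge0 andbT; apply/eqP => h; move: V_gt0.
by rewrite VfunE// -h mulr0 ltxx.
Qed.

Variables (phi : 'rV[R]_d -> R) (K : R).
Hypotheses (sphi : smooth phi) (Kphi : supported K phi).

Let srad : smooth (radial phi). Proof. exact: smooth_radial. Qed.
Let Krad : supported K (radial phi). Proof. exact: supported_radial. Qed.

Let measurable_smooth (f : 'rV[R]_d -> R) : smooth f -> measurable_fun setT f.
Proof. by move=> sf; apply: measurable_rV_continuous; exact: smooth_continuous. Qed.

Lemma Rintegral_linear (f1 f2 : 'rV[R]_d -> R) (a b : R) :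
  Leb.-integrable setT (EFin \o f1) -> Leb.-integrable setT (EFin \o f2) ->
  \int[Leb]_y (a * f1 y + b * f2 y) = a * \int[Leb]_y f1 y + b * \int[Leb]_y f2 y.
Proof.
move=> i1 i2; rewrite RintegralD ?RintegralZl//.
- by have := integrableZl measurableT a i1.
- by have := integrableZl measurableT b i2.
Qed.

Lemma divergence_integral th t : 0 < t < 1 ->
  \int[Leb]_(x in Omega)
    (divergence (fun y => radial_field th phi (t, y)) x * u t x ^+ 2) =
  th t * ((rho t ^+ d)^-1 *
    (d%:R * dilated_moment h1 phi (rho t) + dilated_moment h1 (radial phi) (rho t))).
Proof.
move=> ht.
have divE x : divergence (fun y => radial_field th phi (t, y)) x =
    th t * (d%:R * phi x + radial phi x).
  have -> : (fun y => radial_field th phi (t, y)) = (fun y => (th t * phi y) *: y) by [].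
  exact: divergence_radial_field.
under eq_Rintegral do rewrite divE.
have mH : measurable_fun setT (fun x => th t * (d%:R * phi x + radial phi x)).
  apply: measurable_smooth; apply: smoothM; first exact: smooth_cst.
  by apply: smoothD => //; apply: smoothM => //; exact: smooth_cst.
rewrite (transportU 1 ht mH) muln1.
rewrite mulrCA; congr (_ * _).
rewrite /dilated_moment.
have i1 := dilated_moment_integrable sphi Kphi mh1 bh1 (rho_gt0 ht).
have i2 := dilated_moment_integrable srad Krad mh1 bh1 (rho_gt0 ht).
transitivity (\int[Leb]_y ((th t * d%:R) * (phi (rho t *: y) * h1 y) + th t * (radial phi (rho t *: y) * h1 y))).
  by apply: eq_Rintegral => y _; rewrite /h1; ring.
by rewrite Rintegral_linear//; ring.
Qed.

Lemma momentum_integral th t : 0 < t < 1 -> smooth th ->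
  \int[Leb]_(x in Omega)
    (u t x * dotr ('d (fun y => radial_field th phi (t, y)) x (v t x) +
                   derive1 (fun s => radial_field th phi (s, x)) t) (v t x)) =
  rho t ^+ 2 *
    ((r' t / r t) ^+ 2 * th t *
       (dilated_moment h2 (radial phi) (rho t) + dilated_moment h2 phi (rho t)) +
     (r' t / r t) * 'D_1 th t * dilated_moment h2 phi (rho t)).
Proof.
move=> ht sth; set a := r' t / r t.
pose H x := (a ^+ 2 * th t * (radial phi x + phi x) + a * 'D_1 th t * phi x) * sqnorm x.
have -> : \int[Leb]_(x in Omega)
    (u t x * dotr ('d (fun y => radial_field th phi (t, y)) x (v t x) +
                   derive1 (fun s => radial_field th phi (s, x)) t) (v t x)) =
    \int[Leb]_(x in Omega) (H x * u t x ^+ 1).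
  apply: eq_Rintegral => x; rewrite inE => Ox.
  by rewrite vE// derive1rE// momentum_integrand// mulrC.
rewrite transportU//; last first.
  apply: measurable_funM => //; apply: measurable_smooth.
  apply: smoothD; apply: smoothM; try exact: smooth_cst; try exact: sphi.
  exact: smoothD.
rewrite muln0 expr0 invr1 mul1r.
have i1 := dilated_moment_integrable sphi Kphi mh2 bh2 (rho_gt0 ht).
have i2 := dilated_moment_integrable srad Krad mh2 bh2 (rho_gt0 ht).
transitivity (\int[Leb]_y ((rho t ^+ 2 * a ^+ 2 * th t) * (radial phi (rho t *: y) * h2 y) +
   (rho t ^+ 2 * (a ^+ 2 * th t + a * 'D_1 th t)) * (phi (rho t *: y) * h2 y))).
  by apply: eq_Rintegral => y _; rewrite /H sqnormZ expr1 /h2; ring.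
by rewrite Rintegral_linear// /dilated_moment; ring.
Qed.

Lemma continuous_dilated_moment (h f : 'rV[R]_d -> R) s :
  smooth f -> supported K f -> measurable_fun setT h -> locally_bounded h -> 0 < s ->
  {for s, continuous (dilated_moment h f)}.
Proof.
move=> sf Kf mh bh s0; apply: differentiable_continuous; apply/derivable1_diffP.
by have [] := is_derive_dilated_moment sf Kf mh bh s0.
Qed.

Hypothesis mom : momentum_equation Omega u v.
Variable C : set 'rV[R]_d.
Hypotheses (cC : compact C) (CO : C `<=` Omega°) (Cphi : forall x, ~ C x -> phi x = 0).

(** Near [t0] the derivative [r'] has a constant sign [sg], so that [H] and
[K * r' / r] are [- sg * r' / r t0 * sqrt M] and [sg * F0 / sqrt M] times
[rho ^- d.+1]. After the integration by parts in time, the moments of the radial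
derivative of [phi] against [sqnorm y * U y] cancel at [t0], where [rho] is [1]. *)
Lemma momentum_identity :
  M * (d%:R * dilated_moment h1 phi 1 + dilated_moment h1 (radial phi) 1) =
  d%:R * F0 * dilated_moment h2 phi 1.
Proof.
have /andP[t00 t0lt1] := t01.
pose k := r' t0.
have k0 : k != 0 by exact: speed_neq0.
have rt0 : 0 < r t0 by exact: r_gt0.
have : \forall t \near t0, 0 < r' t * k.
  have : r' t * k @[t --> t0] --> r' t0 * k by apply: cvgM; [exact: cr'|exact: cvg_cst].
  by move/cvgr_gt; apply; rewrite -expr2 exprn_even_gt0.
move=> /nbhs_ballP[e /= e0 ek].
pose tau0 := Num.min e (Num.min t0 (1 - t0)).
have tau00 : 0 < tau0 by rewrite !lt_min e0 t00 subr_gt0.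
have taue : tau0 <= e by rewrite ge_min lexx.
have taut0 : tau0 <= t0 by rewrite !ge_min lexx orbT.
have taut1 : tau0 <= 1 - t0 by rewrite !ge_min lexx !orbT.
have tt (t : R) : `|t - t0| < tau0 -> 0 < t < 1.
  by rewrite ltr_norml => /andP[a b]; apply/andP; split; lra.
have tk (t : R) : `|t - t0| < tau0 -> 0 < r' t * k.
  by move=> h; apply: ek; rewrite /ball/= distrC (lt_le_trans h).
(* the sign of [r'] near [t0] *)
pose sg := Num.sg k.
have sg2 : sg * sg = 1 by rewrite /sg -expr2 sqr_sg k0.
have sg0 : sg != 0 by rewrite sgr_eq0.
have abs (t : R) : `|t - t0| < tau0 -> `|r' t| = sg * r' t.
  move=> /tk h; have kn : `|k| != 0 by rewrite normr_eq0.
  apply: (mulIf kn); rewrite -normrM gtr0_norm// [in LHS](numEsg k) -/sg.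
  by rewrite mulrA (mulrC (r' t)).
have M0 := second_moment_gt0.
pose sM := Num.sqrt M.
have sM0 : 0 < sM by rewrite sqrtr_gt0.
have sM2 : sM * sM = M by rewrite -expr2 sqr_sqrtr// ltW.
have sqV (t : R) : `|t - t0| < tau0 -> Num.sqrt (Vfun Omega u v t) = sg * r' t / r t0 * sM.
  move=> h; rewrite VfunE ?tt// sqrtrM ?sqr_ge0// sqrtr_sqr normrM normfV.
  by rewrite (gtr0_norm rt0) abs.
pose G1 := dilated_moment h1 phi; pose G1r := dilated_moment h1 (radial phi).
pose G2 := dilated_moment h2 phi; pose G2r := dilated_moment h2 (radial phi).
pose c0 := F0 / (sg * sM).
(* coefficients of the bump and of its derivative in the two terms of the
   momentum equation: [g1] in the first, [g2] and [g3] in the second *)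
pose g1 t := - (sg * r' t / r t0 * sM) * ((rho t ^+ d)^-1 * (d%:R * G1 (rho t) + G1r (rho t))).
pose g2 t := c0 * ((rho t ^+ d)^-1 * (r' t / r t0 * (G2r (rho t) + G2 (rho t)))).
pose g3 t := c0 * (rho t * (rho t ^+ d)^-1 * G2 (rho t)).
pose dg3 t := c0 * (((1 - d%:R) * (rho t ^+ d)^-1 * G2 (rho t) +
   rho t * (rho t ^+ d)^-1 * ((rho t)^-1 * G2r (rho t))) * (r' t / r t0)).
have drho (t : R) : 0 < t < 1 -> is_derive t 1 rho (r' t / r t0).
  move=> ht; apply: (is_derive_eq (is_deriveM (dr ht) (is_derive_cst (r t0)^-1 t 1))).
  by rewrite scaler0 add0r /GRing.scale/= mulrC.
have crho (t : R) : 0 < t < 1 -> {for t, continuous rho}.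
  move=> /drho[D _]; apply: differentiable_continuous; exact/derivable1_diffP.
have cV (t : R) : 0 < t < 1 -> {for t, continuous (fun t => (rho t ^+ d)^-1)}.
  move=> ht; apply: continuousV; first by rewrite gt_eqF// exprn_gt0// rho_gt0.
  by apply: (@continuous_comp R R R rho (fun x : R => x ^+ d)); [exact: crho|exact: exprn_continuous].
have cG (f h : 'rV[R]_d -> R) (t : R) : smooth f -> supported K f -> measurable_fun setT h ->
    locally_bounded h -> 0 < t < 1 -> {for t, continuous (fun t => dilated_moment h f (rho t))}.
  move=> sf Kf mh bh ht; apply: (@continuous_comp R R R rho (dilated_moment h f)).
    exact: crho.
  by apply: continuous_dilated_moment => //; exact: rho_gt0.
have cr0 (t : R) : 0 < t < 1 -> {for t, continuous (fun t => r' t / r t0)}.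
  by move=> ht; apply: continuousM; [exact: cr'|exact: cvg_cst].
have H : g1 t0 + g2 t0 - dg3 t0 = 0.
  apply: (@time_localisation R t0 tau0 g1 g2 g3 dg3) => //; try lra.
  - move=> t /tt ht; apply: continuousM.
      apply: continuousN; apply: continuousM; last exact: cvg_cst.
      apply: continuousM; last exact: cvg_cst.
      by apply: continuousM; [exact: cvg_cst|exact: cr'].
    apply: continuousM; first exact: cV.
    apply: continuousD; last exact: cG.
    by apply: continuousM; [exact: cvg_cst|exact: cG].
  - move=> t /tt ht; apply: continuousM; first exact: cvg_cst.
    apply: continuousM; first exact: cV.
    apply: continuousM; first exact: cr0.
    by apply: continuousD; exact: cG.
  - move=> t /tt ht; apply: continuousM; first exact: cvg_cst.
    apply: continuousM; last exact: cr0.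
    apply: continuousD; apply: continuousM.
    + by apply: continuousM; [exact: cvg_cst|exact: cV].
    + exact: cG.
    + by apply: continuousM; [exact: crho|exact: cV].
    + apply: continuousM; last exact: cG.
      apply: continuousV; last exact: crho.
      by rewrite gt_eqF// rho_gt0.
  - move=> t /tt ht.
    have DG := is_derive_dilated_moment sphi Kphi mh2 bh2 (rho_gt0 ht).
    have D3 := is_derive_power_moment d (lt0r_neq0 (rho_gt0 ht)) DG.
    have D3' := is_derive1_comp D3 (drho _ ht).
    apply: (is_derive_eq (is_deriveM (is_derive_cst c0 t 1) D3')).
    by rewrite scaler0 addr0.
  - move=> tau /andP[tau_0 tautau0].
    have sth := @smooth_itv_bump_id R t0 tau.
    pose xi := radial_field (itv_bump t0 tau) phi.
    exists (fun t => Hfun Omega u v t * \int[Leb]_(x in Omega)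
        (divergence (fun y => xi (t, y)) x * u t x ^+ 2)).
    exists (fun t => Kfun Omega u v t * \int[Leb]_(x in Omega)
        (u t x * dotr ('d (fun y => xi (t, y)) x (v t x) +
                       derive1 (fun s => xi (s, x)) t) (v t x))).
    split.
    + move=> t ht htau; rewrite divergence_integral// momentum_integral//.
      rewrite /Hfun /Kfun sqV// FfunE// -/G1 -/G1r -/G2 -/G2r /g1 /g2 /g3 /c0.
      have E : r t = rho t * r t0 by rewrite /rho divfK// gt_eqF.
      have r'0 : r' t != 0 by apply/eqP => h; have := tk _ htau; rewrite h mul0r ltxx.
      have rh0 := rho_gt0 ht.
      split; first by ring.
      rewrite E; field.
      by rewrite r'0 sg0 !gt_eqF// exprn_gt0.
    + move=> t ht htau; rewrite divergence_integral// momentum_integral//.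
      have b0 : itv_bump t0 tau t = 0 by rewrite itv_bump_eq0// (le_trans _ htau)// ltW.
      have -> : 'D_1 (itv_bump t0 tau : R -> R) t = 0.
        by apply: derive_itv_bump_eq0; exact: lt_le_trans htau.
      by rewrite b0 !(mulr0, mul0r) ?addr0 ?mulr0.
    + apply: mom; apply: (momentum_test_radial_field (C := C)) => //; lra.
have rh1 : rho t0 = 1 by rewrite /rho divff// gt_eqF.
move: H; rewrite /g1 /g2 /dg3 /c0 rh1 expr1n invr1 -/k => H.
have : (sg * sM * r t0 / k) * (- (sg * k / r t0 * sM) * (1 * (d%:R * G1 1 + G1r 1)) +
    F0 / (sg * sM) * (1 * (k / r t0 * (G2r 1 + G2 1))) -
    F0 / (sg * sM) * (((1 - d%:R) * 1 * G2 1 + 1 * 1 * (1 * G2r 1)) * (k / r t0))) = 0.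
  by rewrite H mulr0.
have -> : (sg * sM * r t0 / k) * (- (sg * k / r t0 * sM) * (1 * (d%:R * G1 1 + G1r 1)) +
    F0 / (sg * sM) * (1 * (k / r t0 * (G2r 1 + G2 1))) -
    F0 / (sg * sM) * (((1 - d%:R) * 1 * G2 1 + 1 * 1 * (1 * G2r 1)) * (k / r t0))) =
    - ((sg * sg) * (sM * sM) * (d%:R * G1 1 + G1r 1)) + d%:R * F0 * G2 1.
  by field; rewrite k0 sg0 !gt_eqF.
by rewrite sg2 sM2 mul1r addrC => /eqP; rewrite subr_eq0 => /eqP ->.
Qed.

End momentum_identity.

(** * Two tools for the radial equation *)

Section ode_uniqueness.
Context {R : realType}.

(** Squaring removes the kink of the positive part. *)
Lemma is_derive_max0_sqr (y : R) :
  is_derive y 1 (fun z : R => Num.max z 0 ^+ 2) (2 * Num.max y 0).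
Proof.
apply: (@is_derive_quadratic _ _ _ _ 1 1) => // h _.
case: (leP y 0) => y0; case: (leP (y + h) 0) => yh0; rewrite ler_norml; apply/andP; split; nra.
Qed.

(** Let [p] be the truncated parabola. The derivative of [(q ^+ 2 - p ^+ 2) ^+ 2]
is [- 8 * b * l * (q ^+ 2 - p ^+ 2) * (q - p)], which is nonpositive, and the
function vanishes at [0]. The zeros of [q], where the equation for [q] itself
degenerates, need no separate treatment. *)
Lemma ode_unique (b : R) (q : R -> R) : 0 <= b ->
  {within `[0, 1], continuous q} -> (forall l, 0 <= l <= 1 -> 0 <= q l) ->
  (forall l : R, 0 < l < 1 -> is_derive l 1 (fun l => q l ^+ 2) (- (4 * b * l) * q l)) ->
  q 1 = Num.max (q 0 - b) 0.
Proof.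
move=> b0 cq q0 dq.
pose A := q 0.
have A0 : 0 <= A by apply: q0; rewrite lexx ler01.
pose p l := Num.max (A - b * l ^+ 2) 0.
have p0 l : 0 <= p l by rewrite le_max lexx orbT.
have dA (l : R) : is_derive l 1 (fun l : R => A - b * l ^+ 2) (- (2 * b * l)).
  apply: (@is_derive_quadratic _ _ _ _ b 1) => // h _.
  rewrite [X in `|X|](_ : _ = - (b * h ^+ 2)); last by rewrite /=; ring.
  by rewrite normrN ger0_norm// mulr_ge0// sqr_ge0.
have dp (l : R) : is_derive l 1 (fun l => p l ^+ 2) (- (4 * b * l) * p l).
  have H := @is_derive1_comp R (fun z => Num.max z 0 ^+ 2) (fun l => A - b * l ^+ 2) l
    _ _ (is_derive_max0_sqr (A - b * l ^+ 2)) (dA l).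
  by apply: (is_derive_eq H); rewrite /p; ring.
pose D l := q l ^+ 2 - p l ^+ 2.
have dD (l : R) : 0 < l < 1 -> is_derive l 1 (fun l => D l ^+ 2) (- (8 * b * l) * (D l * (q l - p l))).
  move=> hl; have H : is_derive l 1 D (- (4 * b * l) * q l - - (4 * b * l) * p l).
    exact: is_deriveB (dq l hl) (dp l).
  have H2 := is_deriveM H H.
  by apply: (is_derive_eq H2); rewrite /GRing.scale/=; ring.
have cD : {within `[0, 1], continuous (fun l => D l ^+ 2)}.
  have cp : {within `[0, 1], continuous (fun l => p l ^+ 2)}.
    apply: continuous_subspaceT => l; apply: differentiable_continuous.
    by apply/derivable1_diffP; have [] := dp l.
  have cq2 : {within `[0, 1], continuous (fun l => q l ^+ 2)}.
    by move=> l; apply: (@continuous_comp _ _ _ (q : subspace `[0, 1] -> R) (fun x : R => x ^+ 2)); [exact: cq|exact: exprn_continuous].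
  move=> l; apply: (@continuous_comp _ _ _ (D : subspace `[0, 1] -> R) (fun x : R => x ^+ 2)); last exact: exprn_continuous.
  by apply: continuousB; [exact: cq2|exact: cp].
have D1 : D 1 ^+ 2 <= D 0 ^+ 2.
  apply: (@ler0_derive1_nincr _ (fun l => D l ^+ 2) 0 1) => //.
  - by move=> l; rewrite in_itv/= => /dD [].
  - move=> l; rewrite in_itv/= => hl; rewrite derive1E (@derive_val _ _ _ _ _ _ _ (dD l hl)).
    have /andP[l0 l1] := hl.
    rewrite mulNr oppr_le0 mulr_ge0//; first by rewrite !mulr_ge0// ltW.
    have -> : D l * (q l - p l) = (q l - p l) ^+ 2 * (q l + p l) by rewrite /D; ring.
    by rewrite mulr_ge0 ?sqr_ge0// addr_ge0// q0// !ltW.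
have D0 : D 0 = 0.
  by rewrite /D /p expr0n mulr0 subr0 max_l// subrr.
have D10 : D 1 == 0.
  by rewrite -sqrf_eq0 eq_le sqr_ge0 andbT (le_trans D1)// D0 expr0n.
move: D10; rewrite subr_eq0 eqrXn2 ?p0 ?q0 ?lexx ?ler01// => /eqP ->.
by rewrite /p expr1n mulr1.
Qed.

End ode_uniqueness.

Section bump_average.
Context {R : realType} {d : nat}.
Local Notation Leb := (@lebesgue_rV R d).
Variables (w : 'rV[R]_d) (e : R).
Hypothesis e0 : 0 < e.
Local Notation Phi := (bump_rV w e).

Lemma bump_rV_out x : `|x - w| >= e -> Phi x = 0.
Proof.
move=> h; apply: contrapT => hn.
have : forall i, `|x 0 i - w 0 i| < e.
  move=> i; rewrite ltNge; apply/negP => /bump_rV_eq0 /hn; exact.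
move=> hi; move: h; apply/negP; rewrite -ltNge.
have : ball w e x by apply/ball_rVP => // i; rewrite distrC.
by rewrite -ball_normE/= distrC.
Qed.

Lemma bump_rV_supported : supported (`|w| + e) Phi.
Proof.
move=> x hx; apply: bump_rV_out.
by have := lerB_dist x w; apply: le_trans; rewrite lerBrDl ltW.
Qed.

Lemma bump_rV_integrable (g : 'rV[R]_d -> R) :
  measurable_fun setT g -> locally_bounded g ->
  Leb.-integrable setT (EFin \o (fun x => Phi x * g x)).
Proof.
move=> mg bg; apply: integrable_supportedM bump_rV_supported mg bg.
exact/smooth_continuous/smooth_bump_rV.
Qed.

Lemma locally_bounded_cst (c : R) : locally_bounded (fun _ : 'rV[R]_d => c).
Proof. by move=> K; exists `|c|. Qed.

Definition bump_mass := \int[Leb]_x Phi x.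

Lemma integrable_bump : Leb.-integrable setT (EFin \o Phi).
Proof.
have := bump_rV_integrable (measurable_cst (1 : R)) (locally_bounded_cst 1).
by congr (_.-integrable _ _); apply/funext => x /=; rewrite mulr1.
Qed.

Lemma bump_mass_gt0 : 0 < bump_mass.
Proof.
rewrite lt_neqAle; apply/andP; split; last first.
  by apply: Rintegral_ge0 => x _; exact: bump_rV_ge0.
rewrite eq_sym; apply/eqP; rewrite /bump_mass /Rintegral => /eqP.
rewrite fine_eq0; last exact: integrable_fin_num integrable_bump.
move=> /eqP H.
have [H1 _] := ae_eq_integral_abs Leb measurableT (measurable_int _ integrable_bump).
have [|N [mN N0 hN]] := H1 _.
  by rewrite -[RHS]H; apply: eq_integral => x _; rewrite /= ger0_norm ?bump_rV_ge0.
have : (Leb (ball w e) <= Leb N)%E.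
  apply: le_measure; rewrite ?inE//.
    by apply: measurable_rV_open; exact: ball_open.
  move=> x /(ball_rVP _ _ e0) hx; apply: hN => /= /(_ I) []/eqP; rewrite gt_eqF//.
  by apply: bump_rV_gt0 => i; rewrite distrC.
by rewrite N0 lebesgue_rV_ball// leNgt lte_fin exprn_gt0// pmulrn_lgt0.
Qed.

Lemma bump_average (g : 'rV[R]_d -> R) (c eta : R) :
  measurable_fun setT g -> locally_bounded g ->
  (forall x, `|x - w| < e -> `|g x - c| <= eta) ->
  `|\int[Leb]_x (Phi x * g x) - bump_mass * c| <= bump_mass * eta.
Proof.
move=> mg bg hg.
have i1 := bump_rV_integrable mg bg.
have ic (k : R) : Leb.-integrable setT (EFin \o (fun x => k * Phi x)).
  by have := integrableZl measurableT k integrable_bump.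
have i2 : Leb.-integrable setT (EFin \o (fun x => Phi x * g x - c * Phi x)).
  by have := integrableB measurableT i1 (ic c).
have -> : \int[Leb]_x (Phi x * g x) - bump_mass * c =
    \int[Leb]_x (Phi x * g x - c * Phi x).
  by rewrite RintegralB// RintegralZl// ?(mulrC c)//; exact: integrable_bump.
apply: le_trans (le_normr_Rintegral measurableT i2) _.
rewrite mulrC -RintegralZl//; last exact: integrable_bump.
apply: le_Rintegral => //.
  by have := integrable_norm i2.
move=> x _; rewrite (mulrC c) -mulrBr normrM ger0_norm ?bump_rV_ge0// (mulrC eta).
case: (ltP `|x - w| e) => h; last by rewrite bump_rV_out// !mul0r.
by rewrite ler_wpM2l ?bump_rV_ge0// hg.
Qed.

End bump_average.

(** * The profile along rays *)

Lemma affine_scale (R : realType) (V : normedModType R) (k : R) :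
  affine_map (fun x : V => k *: x).
Proof.
have ai : affine_map (fun x : V => x) by split=> // v; exists v => x; rewrite derive_id.
have := affine_shift k 0 ai; congr affine_map.
by apply/funext => x; rewrite addr0.
Qed.

Lemma radial_dilation (R : realType) d (f : 'rV[R]_d -> R) (k : R) x :
  radial (fun y => f (k *: y)) x = radial f (k *: x).
Proof.
rewrite /radial /derive.
suff -> : (fun h : R => h^-1 *: (((fun y => f (k *: y)) \o shift x) (h *: x) - f (k *: x))) =
    (fun h => h^-1 *: ((f \o shift (k *: x)) (h *: (k *: x)) - f (k *: x))) by [].
by apply/funext => h /=; rewrite [k *: (_ + _)]scalerDr !scalerA (mulrC k).
Qed.

Section ray.
Context {R : realType} {d : nat}.
Local Notation Leb := (@lebesgue_rV R d).
Variables (Omega : set 'rV[R]_d) (U : 'rV[R]_d -> R) (kappa L : R).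
Hypotheses (cvO : convex_rV Omega) (O0 : Omega 0).
Hypotheses (mU : measurable_fun setT U) (bU : locally_bounded U)
  (U_ge0 : forall x, 0 <= U x) (lU : lip_in Omega L U) (kappa_ge0 : 0 <= kappa).
Let h1 y := U y ^+ 2.
Let h2 y := sqnorm y * U y.
Let mh1 : measurable_fun setT h1. Proof. exact: measurable_funX. Qed.
Let bh1 : locally_bounded h1. Proof. exact: locally_boundedX. Qed.
Let mh2 : measurable_fun setT h2.
Proof. by apply: measurable_funM => //; exact: measurable_sqnorm. Qed.
Let bh2 : locally_bounded h2.
Proof. exact: locally_boundedM (@locally_bounded_sqnorm R d) bU. Qed.
Hypothesis weakU : forall (phi : 'rV[R]_d -> R) K C, smooth phi -> supported K phi ->
  compact C -> C `<=` Omega° -> (forall x, ~ C x -> phi x = 0) ->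
  d%:R * dilated_moment h1 phi 1 + dilated_moment h1 (radial phi) 1 =
  kappa * dilated_moment h2 phi 1.
Variables (w : 'rV[R]_d) (e0 : R).
Hypotheses (e0_gt0 : 0 < e0) (wO : forall y, ball w e0 y -> Omega y).

Section fixed_radius.
Variable e : R.
Hypotheses (e_gt0 : 0 < e) (ee0 : e < e0).
Local Notation Phi := (bump_rV w e).

Lemma dilated_moment1 (h f : 'rV[R]_d -> R) k :
  dilated_moment h (fun y => f (k *: y)) 1 = dilated_moment h f k.
Proof. by apply: eq_Rintegral => y _; rewrite scale1r. Qed.

(** By convexity the dilated bump is still supported in the interior of [Omega]. *)
Lemma scaled_weak_identity l : 0 < l <= 1 ->
  d%:R * dilated_moment h1 Phi l^-1 + dilated_moment h1 (radial Phi) l^-1 =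
  kappa * dilated_moment h2 Phi l^-1.
Proof.
move=> /andP[l0 l1].
pose C := [set x : 'rV[R]_d | forall i, `[l * w 0 i - l * e, l * w 0 i + l * e]%classic (x 0 i)].
have CE x i : C x -> `|x 0 i - l * w 0 i| <= l * e.
  by move=> /(_ i) /=; rewrite in_itv/= ler_norml => /andP[h3 h4]; apply/andP; split; lra.
have := @weakU (fun y => Phi (l^-1 *: y)) ((`|w| + e) / l^-1) C.
rewrite !dilated_moment1.
have -> : radial (fun y => Phi (l^-1 *: y)) = fun y => radial Phi (l^-1 *: y).
  by apply/funext => y; exact: radial_dilation.
rewrite dilated_moment1; apply.
- apply: smooth_comp_affine (smooth_bump_rV _ _); exact: affine_scale.
- by apply: supported_dilation; [rewrite invr_gt0|exact: bump_rV_supported].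
- apply: (@rV_compact R d (fun i => `[l * w 0 i - l * e, l * w 0 i + l * e]%classic)) => i.
  exact: segment_compact.
- move=> x Cx.
  have xb : ball (l *: w) (l * e0) x.
    apply/ball_rVP => [|i]; first exact: mulr_gt0.
    by rewrite mxE distrC (le_lt_trans (CE _ i Cx))// ltr_pM2l.
  have : nbhs x (ball (l *: w) (l * e0)).
    by apply: open_nbhs_nbhs; split => //; exact: ball_open.
  apply: filterS => y; apply: (ball_scale_sub cvO O0 e0_gt0 wO).
  by rewrite l0.
- move=> x nC; have [i hi] : exists i, l * e < `|x 0 i - l * w 0 i|.
    apply: contrapT => hn; apply: nC => i; rewrite /= in_itv/=.
    have : `|x 0 i - l * w 0 i| <= l * e.
      by rewrite leNgt; apply/negP => hh; apply: hn; exists i.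
    by rewrite ler_norml => /andP[h3 h4]; apply/andP; split; lra.
  apply: (@bump_rV_eq0 _ _ _ _ _ i); rewrite mxE.
  have -> : l^-1 * x 0 i - w 0 i = l^-1 * (x 0 i - l * w 0 i).
    by field; rewrite gt_eqF.
  by rewrite normrM gtr0_norm ?invr_gt0// mulrC ler_pdivlMr// mulrC ltW.
Qed.

Definition bump_sqr (l : R) := \int[Leb]_x (Phi x * U (l *: x) ^+ 2).
Definition bump_mom (l : R) := \int[Leb]_x (Phi x * (sqnorm x * U (l *: x))).

Lemma bump_sqrE l : 0 < l -> bump_sqr l = (l ^+ d)^-1 * dilated_moment h1 Phi l^-1.
Proof.
move=> l0; rewrite /dilated_moment (Rintegral_dilation l0); last first.
  apply: measurable_funM => //.
  apply: measurable_rV_continuous; apply: continuous_dilation.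
  exact/smooth_continuous/smooth_bump_rV.
rewrite mulrA mulVf ?mul1r; last by rewrite gt_eqF// exprn_gt0.
by apply: eq_Rintegral => x _; rewrite scalerA mulVf ?gt_eqF// scale1r.
Qed.

Lemma bump_momE l : 0 < l -> dilated_moment h2 Phi l^-1 = l ^+ d * (l ^+ 2 * bump_mom l).
Proof.
move=> l0; rewrite /dilated_moment (Rintegral_dilation l0); last first.
  apply: measurable_funM => //.
  apply: measurable_rV_continuous; apply: continuous_dilation.
  exact/smooth_continuous/smooth_bump_rV.
congr (_ * _); rewrite -Rintegral_gt0Zl ?exprn_gt0//; last first.
  apply: measurable_funM.
    by apply: measurable_rV_continuous; exact/smooth_continuous/smooth_bump_rV.
  apply: measurable_funM.
    by apply: measurable_rV_continuous; exact: continuous_sqnorm.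
  by apply: (@measurableT_comp _ _ _ _ _ _ U) => //; exact: measurable_scale.
apply: eq_Rintegral => x _; rewrite scalerA mulVf ?gt_eqF// scale1r /h2 sqnormZ; ring.
Qed.

(** The averaged form of the equation for [U (l *: w) ^+ 2]. The Jacobian
[l ^- d] of the dilation produces the summand with [d] in the weak identity. *)
Lemma is_derive_bump_sqr (l : R) : 0 < l <= 1 ->
  is_derive l 1 bump_sqr (- (kappa * l * bump_mom l)).
Proof.
move=> l01; have /andP[l0 l1] := l01.
have ln0 : l != 0 by rewrite gt_eqF.
apply: (@near_eq_is_derive R R R (fun l : R => (l ^+ d)^-1 * dilated_moment h1 Phi l^-1)).
  near=> z; rewrite bump_sqrE//; near: z; exact: lt_nbhsr.
have DV : is_derive l 1 (fun z : R => z^-1) (- l ^- 2).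
  by apply: is_derive_eq; [exact: is_deriveV|rewrite scaler1].
have li0 : 0 < l^-1 by rewrite invr_gt0.
have DG := is_derive_dilated_moment (smooth_bump_rV w e) (@bump_rV_supported _ _ w _ e_gt0) mh1 bh1 li0.
have DC := @is_derive1_comp R (dilated_moment h1 Phi) (fun z => z^-1) l _ _ DG DV.
apply: (is_derive_eq (is_deriveM (is_derive_invX d ln0) DC)).
rewrite /GRing.scale/= invrK.
have W := scaled_weak_identity l01; rewrite bump_momE// in W.
have ld0 : l ^+ d != 0 by rewrite expf_neq0.
transitivity (- (l ^+ d)^-1 / l * (d%:R * dilated_moment h1 Phi l^-1 + dilated_moment h1 (radial Phi) l^-1)).
  by field; rewrite ln0 ld0.
by rewrite W; field; rewrite ln0 ld0.
Unshelve. all: by end_near. Qed.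

End fixed_radius.

Let q (l : R) := U (l *: w).
Let Kw := `|w| + e0.

Let L_ge0 : 0 <= L. Proof. by have [] := lU. Qed.

Lemma le_vanishing (a b c : R) : 0 <= c ->
  (forall e, 0 < e < e0 -> a <= b + c * e) -> a <= b.
Proof.
move=> c0 H; rewrite leNgt; apply/negP => ba.
have c1 : 0 < c + 1 by rewrite ltr_wpDl.
pose e := Num.min (e0 / 2) ((a - b) / (2 * (c + 1))).
have ab0 : 0 < (a - b) / (2 * (c + 1)) by rewrite divr_gt0 ?subr_gt0// mulr_gt0.
have ep : 0 < e by rewrite lt_min ab0 divr_gt0.
have e1 : e <= e0 / 2 by rewrite ge_min lexx.
have e2 : e * (2 * (c + 1)) <= a - b.
  by rewrite -ler_pdivlMr ?mulr_gt0// ge_min lexx orbT.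
have := H e; rewrite ep; have -> : e < e0 by lra.
by move=> /(_ isT); nra.
Qed.

Lemma ray_in l : 0 <= l <= 1 -> Omega (l *: w).
Proof.
move=> /andP[l0 l1]; have Ow : Omega w by apply: wO; exact: ballxx.
by have := cvO Ow O0 (s := l); rewrite l0 l1 scaler0 addr0; apply.
Qed.

Lemma near_ray x l : `|x - w| < e0 -> 0 <= l <= 1 ->
  [/\ Omega (l *: x), `|x| <= Kw & `|l *: x| <= Kw].
Proof.
move=> xw /andP[l0 l1].
have Ox : Omega x by apply: wO; rewrite -ball_normE/= distrC.
have xK : `|x| <= Kw.
  have := lerB_dist x w; move: xw; rewrite /Kw; lra.
split => //; first by have := cvO Ox O0 (s := l); rewrite l0 l1 scaler0 addr0; apply.
by rewrite normrZ ger0_norm// (le_trans _ xK)// ler_piMl.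
Qed.

Lemma U_near_ray e x l : e <= e0 -> `|x - w| < e -> 0 <= l <= 1 ->
  `|U (l *: x) - q l| <= L * e.
Proof.
move=> ee0 xw l01; have [_ HL] := lU.
have [Ox _ _] := near_ray (lt_le_trans xw ee0) l01.
apply: le_trans (HL _ _ Ox (ray_in l01)) _.
rewrite -scalerBr normrZ; have /andP[l0 l1] := l01; rewrite ger0_norm// ler_wpM2l//.
by rewrite (le_trans _ (ltW xw))// ler_piMl.
Qed.

Lemma q_lipschitz a b : 0 <= a <= 1 -> 0 <= b <= 1 -> `|q a - q b| <= L * `|w| * `|a - b|.
Proof.
move=> a01 b01; have [_ HL] := lU.
apply: le_trans (HL _ _ (ray_in a01) (ray_in b01)) _.
by rewrite -scalerBl normrZ -mulrA (mulrC `|w|).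
Qed.

Lemma sqnorm_near (x y : 'rV[R]_d) (K : R) : `|x| <= K -> `|y| <= K ->
  `|sqnorm x - sqnorm y| <= d%:R * (2 * K) * `|x - y|.
Proof.
move=> xK yK; rewrite /sqnorm /dotr -sumrB; apply: le_trans (ler_norm_sum _ _ _) _.
apply: (@le_trans _ _ (\sum_(i < d) (2 * K * `|x - y|))); last first.
  by rewrite sumr_const card_ord -[X in X <= _]mulr_natl !mulrA.
apply: ler_sum => i _.
have -> : x 0 i * x 0 i - y 0 i * y 0 i = (x 0 i + y 0 i) * (x - y) 0 i by rewrite !mxE; ring.
rewrite normrM ler_pM//; last exact: coord_norm_le.
apply: le_trans (ler_normD _ _) _.
have := coord_norm_le x i; have := coord_norm_le y i; lra.
Qed.

Lemma measurable_U_ray l : measurable_fun setT (fun x : 'rV[R]_d => U (l *: x)).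
Proof. by apply: (@measurableT_comp _ _ _ _ _ _ U) => //; exact: measurable_scale. Qed.

Lemma locally_bounded_U_ray l : locally_bounded (fun x : 'rV[R]_d => U (l *: x)).
Proof.
move=> K; have [B B0 HB] := bU (`|l| * K); exists B => // x xK.
by apply: HB; rewrite normrZ ler_wpM2l.
Qed.

(** Apply the mean value theorem to [bump_sqr] and replace averages by values on
the ray. This costs an error of the order of the radius [e] of the bump, which is
arbitrary; moving from the intermediate point to [b] costs another factor
[y - x]. *)
Lemma ray_estimate : exists Cst, forall x y b, 0 < x -> x <= b <= y -> x < y -> y <= 1 ->
  `|q y ^+ 2 - q x ^+ 2 + kappa * b * sqnorm w * q b * (y - x)| <= Cst * (y - x) ^+ 2.
Proof.
have [B B0 HB] := bU Kw.
have [S S0 HS] := @locally_bounded_sqnorm R d Kw.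
have Kw0 : 0 <= Kw by rewrite addr_ge0// ltW.
have s0 : 0 <= sqnorm w by exact: sqnorm_ge0.
have wK : `|w| <= Kw by rewrite lerDl ltW.
pose C1 := L * (2 * B); pose C2 := S * L + B * (d%:R * (2 * Kw)).
have C10 : 0 <= C1 by rewrite !mulr_ge0.
have C20 : 0 <= C2 by rewrite addr_ge0// !mulr_ge0.
exists (kappa * sqnorm w * (B + L * `|w|)) => x y b x0 /andP[xb byy] xy y1.
have qB l : 0 <= l <= 1 -> `|q l| <= B.
  move=> l01; have [||_ _ h] := @near_ray w l; rewrite ?subrr ?normr0//.
  exact: HB.
apply: (@le_vanishing _ _ (2 * C1 + kappa * C2)).
  by rewrite addr_ge0 ?mulr_ge0.
move=> e /andP[ep ee0].
pose N := bump_mass w e.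
have N0 : 0 < N by exact: bump_mass_gt0.
have avg1 l : 0 <= l <= 1 -> `|bump_sqr e l - N * q l ^+ 2| <= N * (C1 * e).
  move=> l01; apply: bump_average => //.
  - by apply: measurable_funX; exact: measurable_U_ray.
  - have := locally_boundedM (locally_bounded_U_ray l) (locally_bounded_U_ray l).
    by congr locally_bounded; apply/funext => z; rewrite expr2.
  - move=> z zw; have [_ _ zK] := near_ray (lt_trans zw ee0) l01.
    have -> : C1 * e = (L * e) * (B + B) by rewrite /C1; ring.
    rewrite subr_sqr normrM ler_pM//; first exact: U_near_ray (ltW ee0) zw l01.
    by apply: le_trans (ler_normD _ _) _; apply: lerD; [exact: HB|exact: qB].
have avg2 l : 0 <= l <= 1 -> `|bump_mom e l - N * (sqnorm w * q l)| <= N * (C2 * e).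
  move=> l01; apply: bump_average => //.
  - apply: measurable_funM; last exact: measurable_U_ray.
    by apply: measurable_rV_continuous; exact: continuous_sqnorm.
  - by apply: locally_boundedM; [exact: locally_bounded_sqnorm|exact: locally_bounded_U_ray].
  - move=> z zw; have [_ zK zlK] := near_ray (lt_trans zw ee0) l01.
    have -> : sqnorm z * U (l *: z) - sqnorm w * q l =
      sqnorm z * (U (l *: z) - q l) + q l * (sqnorm z - sqnorm w) by ring.
    rewrite (le_trans (ler_normD _ _))// /C2 mulrDl lerD// normrM -mulrA.
      by apply: ler_pM => //; [exact: HS|exact: U_near_ray (ltW ee0) zw l01].
    apply: ler_pM => //; first exact: qB.
    apply: le_trans (sqnorm_near zK wK) _.
    by rewrite ler_wpM2l ?mulr_ge0// ltW.
have [z] : exists2 z, z \in `]x, y[ &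
    bump_sqr e y - bump_sqr e x = - (kappa * z * bump_mom e z) * (y - x).
  apply: (@MVT _ (bump_sqr e) (fun z => - (kappa * z * bump_mom e z))) => //.
  - move=> z; rewrite in_itv/= => /andP[z1 z2]; apply: is_derive_bump_sqr => //.
    by apply/andP; split; lra.
  - apply: within_itv_continuous => z /andP[z1 z2]; apply: differentiable_continuous.
    apply/derivable1_diffP; suff: is_derive z 1 (bump_sqr e) (- (kappa * z * bump_mom e z)) by case.
    by apply: is_derive_bump_sqr => //; apply/andP; split; lra.
rewrite in_itv/= => /andP[z1 z2] E.
have y01 : 0 <= y <= 1 by apply/andP; split; lra.
have x01 : 0 <= x <= 1 by apply/andP; split; lra.
have z01 : 0 <= z <= 1 by apply/andP; split; lra.
have b01 : 0 <= b <= 1 by apply/andP; split; lra.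
pose r1 := (bump_sqr e y - N * q y ^+ 2) / N.
pose r2 := (bump_sqr e x - N * q x ^+ 2) / N.
pose r3 := (bump_mom e z - N * (sqnorm w * q z)) / N.
have divN t c : `|t| <= N * c -> `|t / N| <= c.
  by move=> h; rewrite normrM normfV (gtr0_norm N0) ler_pdivrMr// mulrC.
have R1 : `|r1| <= C1 * e by apply: divN; exact: avg1.
have R2 : `|r2| <= C1 * e by apply: divN; exact: avg1.
have R3 : `|r3| <= C2 * e by apply: divN; exact: avg2.
have Ey : bump_sqr e y = N * (q y ^+ 2 + r1) by rewrite /r1; field; rewrite gt_eqF.
have Ex : bump_sqr e x = N * (q x ^+ 2 + r2) by rewrite /r2; field; rewrite gt_eqF.
have Ez : bump_mom e z = N * (sqnorm w * q z + r3) by rewrite /r3; field; rewrite gt_eqF.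
have E2 : q y ^+ 2 + r1 - (q x ^+ 2 + r2) = - (kappa * z * (sqnorm w * q z + r3)) * (y - x).
  apply: (mulfI (lt0r_neq0 N0)); move: E; rewrite Ey Ex Ez => E.
  by rewrite mulrBr E; ring.
have -> : q y ^+ 2 - q x ^+ 2 + kappa * b * sqnorm w * q b * (y - x) =
   (r2 - r1) - (kappa * z * (y - x)) * r3
     - kappa * sqnorm w * (y - x) * (z * q z - b * q b).
  have -> : q y ^+ 2 - q x ^+ 2 = (q y ^+ 2 + r1 - (q x ^+ 2 + r2)) + (r2 - r1) by ring.
  by rewrite E2; ring.
have B1 : `|r2 - r1| <= 2 * C1 * e.
  by rewrite (le_trans (ler_normB _ _))//; move: R1 R2; lra.
have B2 : `|(kappa * z * (y - x)) * r3| <= kappa * C2 * e.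
  have zy0 : 0 <= z * (y - x) by rewrite mulr_ge0//; lra.
  have zy1 : z * (y - x) <= 1 by nra.
  rewrite normrM -[X in _ <= X]mulrA; apply: ler_pM => //.
  rewrite -mulrA normrM (ger0_norm kappa_ge0) (ger0_norm zy0).
  by rewrite ler_piMr.
have B3 : `|kappa * sqnorm w * (y - x) * (z * q z - b * q b)| <=
    kappa * sqnorm w * (B + L * `|w|) * (y - x) ^+ 2.
  have k0 : 0 <= kappa * sqnorm w * (y - x) by rewrite !mulr_ge0// subr_ge0 ltW.
  have zb : `|z - b| <= y - x by rewrite ler_norml; apply/andP; split; lra.
  have h : `|z * q z - b * q b| <= (B + L * `|w|) * (y - x).
    have -> : z * q z - b * q b = (z - b) * q z + b * (q z - q b) by ring.
    rewrite (le_trans (ler_normD _ _))// [X in _ <= X]mulrDl lerD//.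
      by rewrite normrM mulrC ler_pM// qB.
    rewrite normrM; apply: (@le_trans _ _ (1 * (L * `|w| * `|z - b|))).
      apply: ler_pM => //; last exact: q_lipschitz.
      by case/andP: b01 => b0 b1; rewrite ger0_norm.
    by rewrite mul1r ler_wpM2l// mulr_ge0.
  rewrite normrM (ger0_norm k0).
  have := ler_wpM2l k0 h; set X := _ * `|_|; move=> hX; apply: le_trans hX _.
  by rewrite le_eqVlt; apply/orP; left; apply/eqP; ring.
apply: le_trans (ler_normB _ _) _.
apply: le_trans (lerD (ler_normB _ _) (lexx _)) _.
move: B1 B2 B3; lra.
Qed.

Lemma is_derive_ray (l : R) : 0 < l < 1 ->
  is_derive l 1 (fun l => q l ^+ 2) (- (4 * (kappa / 4 * sqnorm w) * l) * q l).
Proof.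
move=> /andP[l0 l1]; have [C HC] := ray_estimate.
apply: (@is_derive_quadratic _ _ _ _ C (Num.min l (1 - l))).
  by rewrite lt_min l0 subr_gt0.
move=> h; rewrite lt_min !ltr_norml => /andP[/andP[g1 g2] /andP[g3 g4]].
have [h0|h0|->] := ltgtP h 0.
- have := HC (l + h) l l; rewrite lexx.
  have -> : 0 < l + h by lra.
  have -> : l + h <= l by lra.
  have -> : l + h < l by lra.
  rewrite (ltW l1) => /(_ isT isT isT isT).
  rewrite -normrN; congr (`|_| <= _); last by ring.
  by field.
- have := HC l (l + h) l; rewrite l0 lexx.
  have -> : l <= l + h by lra.
  have -> : l < l + h by lra.
  have -> : l + h <= 1 by lra.
  move=> /(_ isT isT isT isT).
  congr (`|_| <= _); last by ring.
  by field.
- by rewrite addr0 mulr0 subrr subr0 normr0 expr0n mulr0.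
Qed.

Lemma profile_at_center : U w = Num.max (U 0 - kappa / 4 * sqnorm w) 0.
Proof.
have := @ode_unique R (kappa / 4 * sqnorm w) q.
rewrite /q scale1r scale0r; apply.
- by rewrite mulr_ge0 ?sqnorm_ge0// divr_ge0.
- by apply: (continuous_ray lU cvO O0); apply: wO; exact: ballxx.
- by move=> l _; exact: U_ge0.
- exact: is_derive_ray.
Qed.

End ray.

(** * From one time to all times *)

Lemma max0_lipschitz (R : realType) (a b : R) : `|Num.max a 0 - Num.max b 0| <= `|a - b|.
Proof.
case: (leP a 0) => a0; case: (leP b 0) => b0; rewrite ?subrr ?normr0//.
- by rewrite sub0r normrN gtr0_norm// distrC (le_trans _ (ler_norm _))// lerBrDr; lra.
- by rewrite subr0 gtr0_norm// (le_trans _ (ler_norm _))//; lra.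
Qed.

Lemma continuous_max0 (R : realType) (V : normedModType R) (g : V -> R) :
  continuous g -> continuous (fun x => Num.max (g x) 0).
Proof.
move=> cg x; apply/cvgrPdist_lt => eps eps0.
have := cg x; move/cvgrPdist_lt => /(_ _ eps0); apply: filterS => y.
exact: le_lt_trans (max0_lipschitz _ _).
Qed.

Section profile_form.
Context {R : realType} {d : nat}.
Local Notation Leb := (@lebesgue_rV R d).
Variables (Omega : set 'rV[R]_d) (f : 'rV[R]_d -> R) (L : R).
Hypotheses (cO : closed Omega) (cvO : convex_rV Omega) (O0 : Omega 0)
  (Oneq0 : Leb Omega != 0%E) (lf : lip_in Omega L f).

(** Centres of balls contained in [Omega] are dense in it. *)
Lemma eq_on_centers (m : 'rV[R]_d -> R) : continuous m ->
  (forall w e, 0 < e -> (forall y, ball w e y -> Omega y) -> f w = m w) ->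
  forall x, Omega x -> f x = m x.
Proof.
move=> cm H x Ox.
apply/eqP; rewrite -subr_eq0 -normr_le0; apply/ler_addgt0Pl => eps eps0; rewrite addr0.
have e2 : 0 < eps / 2 by rewrite divr_gt0.
have [d1 d10 h1] := lip_in_close lf Ox e2.
have /nbhs_ballP[d2 /= d20 h2] : nbhs x [set y | `|m x - m y| < eps / 2].
  by have := cm x; move/cvgrPdist_lt; apply.
have [w [e [e0 Ow]]] := convex_pos_ball (measurable_rV_closed cO) cvO Oneq0.
have d0 : 0 < Num.min d1 d2 by rewrite lt_min d10.
have [c [e' [e'0 hc]]] := convex_ball_dense cvO e0 Ow Ox d0.
have [Oc xc] := hc c (ballxx _ e'0).
have fmc : f c = m c by apply: (H c e') => // y /hc[].
have b1 : `|f x - f c| < eps / 2.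
  by apply: h1 => //; apply: le_ball xc; rewrite ge_min lexx.
have b2 : `|m x - m c| < eps / 2.
  by apply: h2; apply: le_ball xc; rewrite ge_min lexx orbT.
have -> : f x - m x = (f x - f c) - (m x - m c) by rewrite fmc; ring.
rewrite (le_trans (ler_normB _ _))//; lra.
Qed.

(** Points where the almost sure identity holds are dense, and both sides are
continuous. *)
Lemma eq_on_ae (g : 'rV[R]_d -> R) (P : set 'rV[R]_d) (k a L' : R) : 0 <= a ->
  lip_in Omega L' g ->
  {ae Leb, forall x, P x -> f x = a * g (k *: x)} ->
  forall x, Omega x -> (exists2 dlt, 0 < dlt & forall y, Omega y -> ball x dlt y ->
    P y /\ Omega (k *: y)) -> f x = a * g (k *: x).
Proof.
move=> a0 lg ae x Ox [dlt dlt0 hP]; have [L'0 HL'] := lg.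
apply/eqP; rewrite -subr_eq0 -normr_le0; apply/ler_addgt0Pl => eps eps0; rewrite addr0.
have e2 : 0 < eps / 2 by rewrite divr_gt0.
have [d1 d10 h1] := lip_in_close lf Ox e2.
pose c := a * (L' * `|k|) + 1.
have c0 : 0 < c by rewrite ltr_wpDl// !mulr_ge0.
pose d2 := Num.min dlt (Num.min d1 (eps / 2 / c)).
have d20 : 0 < d2 by rewrite !lt_min dlt0 d10 divr_gt0.
have [y [Oy xy Py]] := ae_dense_convex (measurable_rV_closed cO) cvO Oneq0 ae Ox d20.
have [|PPy Oky] := hP y Oy; first by apply: le_ball xy; rewrite ge_min lexx.
have Okx : Omega (k *: x) by have [] := hP x Ox (ballxx _ dlt0).
have b1 : `|f x - f y| < eps / 2.
  by apply: h1 => //; apply: le_ball xy; rewrite !ge_min lexx orbT.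
have b2 : `|a * g (k *: x) - a * g (k *: y)| <= eps / 2.
  rewrite -mulrBr normrM ger0_norm//.
  have xy2 : `|x - y| <= eps / 2 / c.
    move: xy; rewrite -ball_normE /= => /ltW/le_trans; apply.
    by rewrite !ge_min lexx !orbT.
  apply: (@le_trans _ _ (a * (L' * `|k|) * `|x - y|)).
    rewrite -!mulrA ler_wpM2l//; apply: le_trans (HL' _ _ Okx Oky) _.
    by rewrite -scalerBr normrZ.
  apply: (@le_trans _ _ (c * `|x - y|)); first by rewrite ler_wpM2r// lerDl.
  by rewrite mulrC -ler_pdivlMr.
have -> : f x - a * g (k *: x) = (f x - f y) - (a * g (k *: x) - a * g (k *: y)).
  by rewrite (Py PPy); ring.
rewrite (le_trans (ler_normB _ _))//; lra.
Qed.

End profile_form.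

Section self_similar_densities.
Context {R : realType} {d : nat}.
Local Notation Leb := (@lebesgue_rV R d).
Variables (Omega : set 'rV[R]_d) (f g : 'rV[R]_d -> R) (Lf Lg rho A B : R).
Hypotheses (cO : closed Omega) (cvO : convex_rV Omega) (O0 : Omega 0)
  (Oneq0 : Leb Omega != 0%E) (lf : lip_in Omega Lf f) (lg : lip_in Omega Lg g)
  (rho0 : 0 < rho) (B0 : 0 <= B).
Hypothesis fg : {ae Leb, forall x, (f \_ Omega) x = (rho ^+ d)^-1 * (g \_ Omega) (rho^-1 *: x)}.
Hypothesis gf : {ae Leb, forall x, (g \_ Omega) x = (rho^-1 ^+ d)^-1 * (f \_ Omega) (rho *: x)}.
Hypothesis gE : forall x, Omega x -> g x = Num.max (A - B * sqnorm x) 0.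

Let rhod0 : 0 < (rho ^+ d)^-1. Proof. by rewrite invr_gt0 exprn_gt0. Qed.

Let shrink k x : 0 <= k <= 1 -> Omega x -> Omega (k *: x).
Proof. by move=> k01 Ox; have := cvO Ox O0 k01; rewrite scaler0 addr0. Qed.

(** One of the two dilations by [rho] and [rho^-1] maps [Omega] into itself; the
almost everywhere relation is used in that direction. *)
Lemma scaling_inside x : Omega x -> Omega (rho^-1 *: x) ->
  f x = (rho ^+ d)^-1 * g (rho^-1 *: x).
Proof.
move=> Ox Orx; case: (leP 1 rho) => rho1.
  have k01 : 0 <= rho^-1 <= 1 by rewrite invr_ge0 (ltW rho0) invf_le1.
  apply: (eq_on_ae (P := Omega) cO cvO Oneq0 lf (ltW rhod0) lg) => //.
    apply: filterS fg => y + Oy; rewrite !patchE !mem_set//; exact: shrink.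
  by exists 1 => // y Oy _; split => //; exact: shrink.
have k01 : 0 <= rho <= 1 by rewrite !ltW.
have H : g (rho^-1 *: x) = (rho^-1 ^+ d)^-1 * f (rho *: (rho^-1 *: x)).
  apply: (eq_on_ae (P := Omega) cO cvO Oneq0 lg _ lf) => //.
  - by rewrite invr_ge0 exprn_ge0// invr_ge0 ltW.
  - apply: filterS gf => y + Oy; rewrite !patchE !mem_set//; exact: shrink.
  - by exists 1 => // y Oy _; split => //; exact: shrink.
rewrite H scalerA divff ?gt_eqF// scale1r exprVn invrK mulrA mulVf ?mul1r//.
by rewrite gt_eqF// exprn_gt0.
Qed.

(** The points [y] with [rho^-1 *: y] outside [Omega] form an open set on which [f]
vanishes almost everywhere. *)
Lemma scaling_outside x : Omega x -> ~ Omega (rho^-1 *: x) -> f x = 0.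
Proof.
move=> Ox nOx; pose P := [set y | Omega y /\ ~ Omega (rho^-1 *: y)].
pose Q := [set y | ~ Omega (rho^-1 *: y)].
have oQ : open Q.
  apply: (@open_comp _ _ (fun y : 'rV[R]_d => rho^-1 *: y) (~` Omega)).
    by move=> y _; exact: scaler_continuous.
  exact: closed_openC.
have [dlt dlt0 hQ] : exists2 dlt, 0 < dlt & forall y, ball x dlt y -> Q y.
  have /nbhs_ballP[e /= e0 h] : nbhs x Q by apply: open_nbhs_nbhs.
  by exists e.
apply: contrapT => fx0.
have fx : 0 < `|f x| by rewrite normr_gt0; exact/eqP.
have [d1 d10 h1] := lip_in_close lf Ox fx.
have d20 : 0 < Num.min d1 dlt by rewrite lt_min d10.
have [y [Oy xy Py]] := ae_dense_convex (measurable_rV_closed cO) cvO Oneq0 fg Ox d20.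
have : f y = 0.
  move: Py; rewrite patchE mem_set// patchE memNset ?mulr0//.
  by apply: hQ; apply: le_ball xy; rewrite ge_min lexx orbT.
have xb : ball x d1 y by apply: le_ball xy; rewrite ge_min lexx.
by move=> fy; have := h1 y Oy xb; rewrite fy subr0 ltxx.
Qed.

(** If [rho^-1 *: x] is outside [Omega], then [f x = 0], and the parabola has to be
nonpositive at [x]. Otherwise its value [c] at [x] is positive, and along the
segment from [0] to [x] the continuous function [f] takes the value [0] or values
at least [c], and both kinds occur. *)
Lemma barenblatt_scaling x : Omega x ->
  f x = Num.max ((rho ^+ d)^-1 * A - (rho ^+ d)^-1 * B / rho ^+ 2 * sqnorm x) 0.
Proof.
have form z : Omega (z) -> Omega (rho^-1 *: z) ->
    f z = Num.max ((rho ^+ d)^-1 * A - (rho ^+ d)^-1 * B / rho ^+ 2 * sqnorm z) 0.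
  move=> Oz Orz; rewrite scaling_inside// gE// sqnormZ maxr_pMr ?ltW// mulr0; congr (Num.max _ _).
  by rewrite exprVn; ring.
move=> Ox; have [Orx|nOrx] := pselect (Omega (rho^-1 *: x)); first exact: form.
rewrite scaling_outside// max_r//; rewrite leNgt; apply/negP => c0.
set c := (X in 0 < X) in c0.
have rh2 : 0 <= (rho ^+ d)^-1 * B / rho ^+ 2.
  by rewrite mulr_ge0// ?invr_ge0 ?exprn_ge0 ?mulr_ge0// ltW.
pose h (l : R) := f (l *: x).
have ch : {within `[0, 1], continuous h} by exact: (continuous_ray lf cvO O0 Ox).
have h1 : h 1 = 0 by rewrite /h scale1r; exact: scaling_outside.
have hin l : 0 <= l <= 1 -> h l = 0 \/ c <= h l.
  move=> l01; have Olx := shrink l01 Ox.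
  have [Orl|nOrl] := pselect (Omega (rho^-1 *: (l *: x))); last by left; exact: scaling_outside.
  right; rewrite /h form// le_max; apply/orP; left; rewrite /c lerD2l lerN2 ler_wpM2l//.
  rewrite sqnormZ ler_piMl ?sqnorm_ge0// expr_le1//; by case/andP: l01.
have h0 : c <= h 0.
  rewrite /h scale0r form ?scaler0// le_max; apply/orP; left; rewrite /c lerD2l lerN2.
  rewrite ler_wpM2l//; have := sqnormZ 0 x; rewrite scale0r => ->.
  by rewrite expr0n mul0r sqnorm_ge0.
(* the forbidden value [c / 2] is attained *)
have [l] : exists2 l, l \in `[0, 1] & h l = c / 2.
  have h00 : 0 <= h 0 by exact: le_trans (ltW c0) h0.
  apply: IVT => //; rewrite h1 (min_r h00) (max_l h00).
  by apply/andP; split; lra.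
rewrite in_itv/= => l01 hl; have [] := hin l l01; rewrite hl; lra.
Qed.

End self_similar_densities.

(** * The self-similar solutions *)

Theorem theorem3p2 (R : realType) (d : nat) (Omega : set 'rV[R]_d)
    (u : R -> 'rV[R]_d -> R) (v : R -> 'rV[R]_d -> 'rV[R]_d)
    (mu0 mu1 : probability 'rV[R]_d R)
    (closed_Omega : closed Omega) (convex_Omega : convex_set Omega)
    (Omega0 : Omega 0)
    (ss : self_similar Omega u v)
    (V_gt0 : {ae @lebesgue_measure R, forall t : R, 0 < t < 1 ->
                0 < Vfun Omega u v t})
    (sol : solution Omega u v mu0 mu1)
    (lip_u : forall t, 0 <= t <= 1 -> [lipschitz u t x | x in Omega]) :
  exists A B : R -> R, forall t, 0 <= t <= 1 ->
    [/\ 0 < A t, 0 < B t &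
        forall x, Omega x -> u t x = Num.max (A t - B t * sqnorm x) 0].
Proof.
have [mubar [r [mu [[[cr [r' cr' dr]] r01] Hmu _ vE]]]] := ss.
have [mom _ _ _] := sol.
have cvO := convex_setP convex_Omega.
have lipu (t : R) : 0 <= t <= 1 -> exists L, lip_in Omega L (u t).
  by move=> /lip_u; exact: lipschitz_lip_in.
have r_gt0 (t : R) : 0 <= t <= 1 -> 0 < r t by move=> /r01/andP[].
have muE (t : R) : 0 <= t <= 1 -> forall A, measurable A ->
    mu t A = (\int[@lebesgue_rV R d]_(x in A `&` Omega) (u t x)%:E)%E /\
    mu t A = pushforward mubar (fun x => r t *: x) A.
  by move=> /Hmu[_].
have Oneq0 := Omega_not_null closed_Omega lipu muE.
(* a time at which the velocity does not vanish *)
have [t0 [t001 V0]] : exists t0, 0 < t0 < 1 /\ 0 < Vfun Omega u v t0.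
  apply: contrapT => hn; have [N [mN N0 hN]] := V_gt0.
  have : (lebesgue_measure (`]0%R, 1%R[%classic : set R) <= lebesgue_measure N)%E.
    apply: le_measure; rewrite ?inE//.
    move=> t /=; rewrite in_itv/= => ht; apply: hN => /= /(_ ht) Vt.
    by apply: hn; exists t.
  by rewrite N0 lebesgue_measure_itv/= lte_fin ltr01 -EFinD lee_fin subr0 ler10.
have c01 (t : R) : 0 < t < 1 -> 0 <= t <= 1 by move=> /andP[/ltW -> /ltW ->].
have t0c := c01 _ t001.
pose U := dens Omega u t0.
have mU : measurable_fun setT U by exact: (measurable_dens closed_Omega lipu t0c).
have [L lU'] := lipu _ t0c.
have bU : locally_bounded U by exact: locally_bounded_lip_in lU' Omega0.
have U_ge0 x : 0 <= U x by exact: (dens_ge0 closed_Omega cvO lipu muE).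
have UE x : Omega x -> U x = u t0 x by move=> Ox; rewrite /U /dens patchE mem_set.
have lU : lip_in Omega L U.
  by have [L0 HL] := lU'; split => // x y Ox Oy; rewrite !UE//; exact: HL.
have r_gt0' (t : R) : 0 < t < 1 -> 0 < r t by move=> /c01/r_gt0.
have trU (t : R) k (H : 'rV[R]_d -> R) : 0 < t < 1 -> measurable_fun setT H ->
  \int[@lebesgue_rV R d]_(x in Omega) (H x * u t x ^+ k.+1) =
  ((r t / r t0) ^+ (d * k))^-1 *
    \int[@lebesgue_rV R d]_y (H ((r t / r t0) *: y) * U y ^+ k.+1).
  by move=> /c01 ht mH; exact: (transport closed_Omega cvO lipu r_gt0 muE).
have cr'0 (t : R) : 0 < t < 1 -> {for t, continuous r'}.
  by move=> ht; apply: (within_continuous_continuous ltr01 cr'); rewrite in_itv.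
have vE' (t : R) x : 0 < t < 1 -> Omega x -> v t x = (derive1 r t / r t) *: x by move=> ht; exact: vE.
set M := \int[@lebesgue_rV R d]_y (sqnorm y * U y).
set F0 := \int[@lebesgue_rV R d]_y (U y ^+ 2).
have M0 : 0 < M := second_moment_gt0 mU U_ge0 r_gt0' t001 trU dr vE' V0.
have F0_ge0 : 0 <= F0 by apply: Rintegral_ge0 => y _; exact: sqr_ge0.
(* in dimension [0] the second moment [M] is [0] *)
have d0 : (0 < d)%N.
  rewrite lt0n; apply/eqP => d0; move: M0; rewrite /M.
  under eq_Rintegral => y _.
    have -> : sqnorm y = 0 by apply: big1 => i; have := ltn_ord i; rewrite [X in (_ < X)%N]d0.
    rewrite mul0r; over.
  by rewrite Rintegral_cst// mul0r ltxx.
pose kappa := d%:R * F0 / M.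
have kappa0 : 0 <= kappa by rewrite !mulr_ge0// invr_ge0 ltW.
have weakU (phi : 'rV[R]_d -> R) K C : smooth phi -> supported K phi ->
    compact C -> C `<=` Omega° -> (forall x, ~ C x -> phi x = 0) ->
    d%:R * dilated_moment (fun y => U y ^+ 2) phi 1 +
      dilated_moment (fun y => U y ^+ 2) (radial phi) 1 =
    kappa * dilated_moment (fun y => sqnorm y * U y) phi 1.
  move=> sphi Kphi cC CO Cphi; apply: (mulfI (lt0r_neq0 M0)).
  rewrite (momentum_identity mU bU U_ge0 r_gt0' t001 trU dr cr'0 vE' V0 sphi Kphi mom cC CO Cphi).
  by rewrite /kappa mulrA (mulrCA M) divff ?mulr1// gt_eqF.
have gE x : Omega x -> u t0 x = Num.max (U 0 - kappa / 4 * sqnorm x) 0.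
  apply: (eq_on_centers closed_Omega cvO Oneq0 lU' (m := fun x => Num.max (U 0 - kappa / 4 * sqnorm x) 0)).
    apply: (@continuous_max0 R 'rV[R]_d (fun x => U 0 - kappa / 4 * sqnorm x)) => y.
    apply: (@continuousB _ _ _ (cst (U 0)) (fun x => kappa / 4 * sqnorm x)).
      exact: cst_continuous.
    apply: (@continuousM _ _ (cst (kappa / 4)) (@sqnorm R d)); first exact: cst_continuous.
    exact: continuous_sqnorm.
  move=> w e e0 wO; rewrite -UE; last by apply: wO; exact: ballxx.
  exact: (profile_at_center cvO Omega0 mU bU U_ge0 lU kappa0 weakU e0 wO).
have intU : \int[@lebesgue_rV R d]_x U x = 1.
  by rewrite /Rintegral (integral_dens muE t0c).
have UnO x : ~ Omega x -> U x = 0 by move=> nOx; rewrite /U /dens patchE memNset.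
have sq_ge0 : forall x : 'rV[R]_d, 0 <= sqnorm x := @sqnorm_ge0 R d.
(* otherwise [U] vanishes, against the total mass [1] *)
have U00 : 0 < U 0.
  rewrite lt_neqAle U_ge0 andbT; apply/eqP => U0.
  have Uz x : U x = 0.
    have [Ox|] := pselect (Omega x); last exact: UnO.
    by rewrite UE// gE// -U0 sub0r max_r// oppr_le0 mulr_ge0// divr_ge0.
  move: intU; under eq_Rintegral do rewrite Uz.
  by rewrite Rintegral_cst// mul0r => /eqP; rewrite eq_sym oner_eq0.
(* If [F0] were [0], as it is also by convention when [U ^+ 2] is not
   integrable, then [kappa = 0] and [U] would be the constant [U 0] on
   [Omega], so that [F0 = U 0 > 0]. *)
have F00 : 0 < F0.
  rewrite lt_neqAle F0_ge0 andbT; apply/eqP => F00.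
  have Uc x : U x ^+ 2 = U 0 * U x.
    have [Ox|nOx] := pselect (Omega x); last by rewrite UnO// expr0n mulr0.
    have -> : U x = U 0; last by rewrite expr2.
    by rewrite UE// gE// /kappa -F00 mulr0 !mul0r subr0 max_l.
  have : F0 = U 0.
    rewrite /F0; under eq_Rintegral do rewrite Uc.
    by rewrite Rintegral_gt0Zl// intU mulr1.
  by rewrite -F00 => U0; move: U00; rewrite -U0 ltxx.
have kappa1 : 0 < kappa by rewrite divr_gt0// mulr_gt0// ltr0n.
pose rho t := r t / r t0.
exists (fun t => (rho t ^+ d)^-1 * U 0), (fun t => (rho t ^+ d)^-1 * (kappa / 4) / rho t ^+ 2).
move=> t t01; have rho0 : 0 < rho t by rewrite divr_gt0// r_gt0.
have rhod : 0 < (rho t ^+ d)^-1 by rewrite invr_gt0 exprn_gt0.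
split; first exact: mulr_gt0.
  by rewrite divr_gt0 ?exprn_gt0// mulr_gt0// divr_gt0.
move=> x Ox; have [Lt lt] := lipu _ t01.
have k4 : 0 <= kappa / 4 by rewrite divr_ge0.
apply: (barenblatt_scaling closed_Omega cvO Omega0 Oneq0 lt lU' rho0 k4 _ _ gE Ox).
- exact: (dens_scaling closed_Omega cvO lipu r_gt0 muE t0c t01).
- have := dens_scaling closed_Omega cvO lipu r_gt0 muE t01 t0c.
  rewrite (_ : r t0 / r t = (rho t)^-1) ?invrK//.
  by rewrite /rho invf_div.
Qed.
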